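(* Let $\mathbf{SC}^{\mathbf k}_{\top,\bot}$ be the free symmetric bimonoidal intermuting category generated by a nonempty set of objects (letters). If $f,g:A\to B$ are arrows of $\mathbf{SC}^{\mathbf k}_{\top,\bot}$ such that either both $A$ and $B$ are pure and diversified, or no letter occurs in $A$ and $B$, then $f=g$ in $\mathbf{SC}^{\mathbf k}_{\top,\bot}$.
   Context: Throughout, $\xi\in\{\wedge,\vee\}$; hats mark the natural transformations attached to $\wedge$ and checks those attached to $\vee$; $b$, $c$ without accent stand for the version belonging to $\xi$. A symmetric bimonoidal intermuting category is $\langle\mathcal A,\wedge,\vee,\top,\bot\rangle$ where $\wedge,\vee:\mathcal A\times\mathcal A\to\mathcal A$ are functors, $\top,\bot$ are objects, and there are: (1) natural isomorphisms $\hat b^{\to}_{A,B,C}:A\wedge(B\wedge C)\to(A\wedge B)\wedge C$, $\check b^{\to}_{A,B,C}:A\vee(B\vee C)\to(A\vee B)\vee C$, with inverses $\hat b^{\leftarrow}_{A,B,C},\check b^{\leftarrow}_{A,B,C}$, each satisfying $b^{\to}_{A\xi B,C,D}\circ b^{\to}_{A,B,C\xi D}=(b^{\to}_{A,B,C}\,\xi\,\mathbf 1_D)\circ b^{\to}_{A,B\xi C,D}\circ(\mathbf 1_A\,\xi\, b^{\to}_{B,C,D})$; (2) natural self-inverse isomorphisms $\hat c_{A,B}:A\wedge B\to B\wedge A$, $\check c_{A,B}:A\vee B\to B\vee A$, each satisfying $c_{A,B\xi C}=b^{\to}_{B,C,A}\circ(\mathbf 1_B\,\xi\, c_{A,C})\circ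 b^{\leftarrow}_{B,A,C}\circ(c_{A,B}\,\xi\,\mathbf 1_C)\circ b^{\to}_{A,B,C}$; (3) natural isomorphisms $\hat\delta^{\to}_A:A\wedge\top\to A$, $\hat\sigma^{\to}_A:\top\wedge A\to A$, $\check\delta^{\to}_A:A\vee\bot\to A$, $\check\sigma^{\to}_A:\bot\vee A\to A$, with inverses $\hat\delta^{\leftarrow},\hat\sigma^{\leftarrow},\check\delta^{\leftarrow},\check\sigma^{\leftarrow}$, with $\hat\delta^{\to}_\top=\hat\sigma^{\to}_\top$, $\check\delta^{\to}_\bot=\check\sigma^{\to}_\bot$, $\hat b^{\to}_{A,\top,C}=\hat\delta^{\leftarrow}_A\wedge\hat\sigma^{\to}_C$, $\check b^{\to}_{A,\bot,C}=\check\delta^{\leftarrow}_A\vee\check\sigma^{\to}_C$; (4) isomorphisms $\hat w^{\leftarrow}_\bot:\bot\to\bot\wedge\bot$ and $\check w^{\to}_\top:\top\vee\top\to\top$ with inverses $\hat w^{\to}_\bot$, $\check w^{\leftarrow}_\top$, satisfying $\check w^{\to}_\top\circ(\check w^{\to}_\top\vee\mathbf 1_\top)\circ\check b^{\to}_{\top,\top,\top}=\check w^{\to}_\top\circ(\mathbf 1_\top\vee\check w^{\to}_\top)$, $\hat b^{\leftarrow}_{\bot,\bot,\bot}\circ(\hat w^{\leftarrow}_\bot\wedge\mathbf 1_\bot)\circ\hat w^{\leftarrow}_\bot=(\mathbf 1_\bot\wedge\hat w^{\leftarrow}_\bot)\circ\hat w^{\leftarrow}_\bot$, $\check w^{\to}_\top\circ\check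 c_{\top,\top}=\check w^{\to}_\top$, $\hat c_{\bot,\bot}\circ\hat w^{\leftarrow}_\bot=\hat w^{\leftarrow}_\bot$; (5) an arrow $\kappa:\bot\to\top$ with $\check\delta^{\to}_\top=\check w^{\to}_\top\circ(\mathbf 1_\top\vee\kappa)$, $\check\sigma^{\to}_\top=\check w^{\to}_\top\circ(\kappa\vee\mathbf 1_\top)$, $\hat\delta^{\leftarrow}_\bot=(\mathbf 1_\bot\wedge\kappa)\circ\hat w^{\leftarrow}_\bot$, $\hat\sigma^{\leftarrow}_\bot=(\kappa\wedge\mathbf 1_\bot)\circ\hat w^{\leftarrow}_\bot$; (6) a natural transformation $c^k_{A,B,C,D}:(A\wedge B)\vee(C\wedge D)\to(A\vee C)\wedge(B\vee D)$ satisfying $$c^k_{A_1\vee A_2,A_1'\vee A_2',A_3,A_3'}\circ(c^k_{A_1,A_1',A_2,A_2'}\vee\mathbf 1_{A_3\wedge A_3'})\circ\check b^{\to}_{A_1\wedge A_1',A_2\wedge A_2',A_3\wedge A_3'}=(\check b^{\to}_{A_1,A_2,A_3}\wedge\check b^{\to}_{A_1',A_2',A_3'})\circ c^k_{A_1,A_1',A_2\vee A_3,A_2'\vee A_3'}\circ(\mathbf 1_{A_1\wedge A_1'}\vee c^k_{A_2,A_2',A_3,A_3'}),$$ $$\hat b^{\leftarrow}_{A_1\vee A_1',A_2\vee A_2',A_3\vee A_3'}\circ(c^k_{A_1,A_2,A_1',A_2'}\wedge\mathbf 1_{A_3\vee A_3'})\circ c^k_{A_1\wedge A_2,A_3,A_1'\wedge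 A_2',A_3'}=(\mathbf 1_{A_1\vee A_1'}\wedge c^k_{A_2,A_3,A_2',A_3'})\circ c^k_{A_1,A_2\wedge A_3,A_1',A_2'\wedge A_3'}\circ(\hat b^{\leftarrow}_{A_1,A_2,A_3}\vee\hat b^{\leftarrow}_{A_1',A_2',A_3'}),$$ $$c^k_{A_2,A_2',A_1,A_1'}\circ\check c_{A_1\wedge A_1',A_2\wedge A_2'}=(\check c_{A_1,A_2}\wedge\check c_{A_1',A_2'})\circ c^k_{A_1,A_1',A_2,A_2'},$$ $$\hat c_{A_1\vee A_1',A_2\vee A_2'}\circ c^k_{A_1,A_2,A_1',A_2'}=c^k_{A_2,A_1,A_2',A_1'}\circ(\hat c_{A_1,A_2}\vee\hat c_{A_1',A_2'}),$$ $$\check\delta^{\to}_{A\wedge A'}=(\check\delta^{\to}_A\wedge\check\delta^{\to}_{A'})\circ c^k_{A,A',\bot,\bot}\circ(\mathbf 1_{A\wedge A'}\vee\hat w^{\leftarrow}_\bot),\quad \check\sigma^{\to}_{A\wedge A'}=(\check\sigma^{\to}_A\wedge\check\sigma^{\to}_{A'})\circ c^k_{\bot,\bot,A,A'}\circ(\hat w^{\leftarrow}_\bot\vee\mathbf 1_{A\wedge A'}),$$ $$\hat\delta^{\leftarrow}_{A\vee A'}=(\mathbf 1_{A\vee A'}\wedge\check w^{\to}_\top)\circ c^k_{A,\top,A',\top}\circ(\hat\delta^{\leftarrow}_A\vee\hat\delta^{\leftarrow}_{A'}),\quad \hat\sigma^{\leftarrow}_{A\vee A'}=(\check w^{\to}_\top\wedge\mathbf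 1_{A\vee A'})\circ c^k_{\top,A,\top,A'}\circ(\hat\sigma^{\leftarrow}_A\vee\hat\sigma^{\leftarrow}_{A'}),$$ $$\hat\delta^{\to}_\top\circ(\check\delta^{\to}_\top\wedge\check\sigma^{\to}_\top)\circ c^k_{\top,\bot,\bot,\top}=\kappa\circ\check\delta^{\to}_\bot\circ(\hat\sigma^{\to}_\bot\vee\hat\delta^{\to}_\bot),\quad \hat\delta^{\to}_\top\circ(\check\sigma^{\to}_\top\wedge\check\delta^{\to}_\top)\circ c^k_{\bot,\top,\top,\bot}=\kappa\circ\check\delta^{\to}_\bot\circ(\hat\delta^{\to}_\bot\vee\hat\sigma^{\to}_\bot).$$ The free such category generated by a set of letters: objects are the formulae built from letters and the constants $\top,\bot$ by the binary connectives $\wedge,\vee$. Arrow terms are typed expressions generated from $\mathbf 1_A$ and all components (with formulae as indices) of the transformations and arrows above and their stated inverses, by composition $\circ$ (when types match) and the operations $\wedge,\vee$. Arrows are equivalence classes of arrow terms under the smallest equivalence relation, congruent with respect to $\circ,\wedge,\vee$, containing the category equations, functoriality of $\wedge,\vee$, naturality and isomorphism equations, and the equations listed above. Normal form $\nu(A)$ of a formula: $\nu(p)=p$ for a letter $p$; $\nu(\zeta)=\zeta$ for $\zeta\in\{\top,\bot\}$; $\nu(A_1\,\xi\, A_2)$ is $\zeta$ if $\nu(A_1)=\nu(A_2)=\zeta\in\{\top,\bot\}$; it is $\nu(A_i)$ if $\nu(A_{3-i})=\zeta\neq\nu(A_i)$ and $(\xi,\zeta)\in\{(\wedge,\top),(\vee,\bot)\}$,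 $i\in\{1,2\}$; otherwise it is $\nu(A_1)\,\xi\,\nu(A_2)$. A formula $A$ is pure when neither $\top$ nor $\bot$ occurs in $\nu(A)$; it is diversified when every letter occurs in it at most once. *)

(* Defs.v *)
From Stdlib Require Import List Bool.

Set Implicit Arguments.
Unset Strict Implicit.
Unset Printing Implicit Defensive.

(* The two connectives.  A connective also names its unit below, so that the
   parts of the definition that are stated uniformly in xi are written once. *)
Inductive conn : Type := And | Or.

Inductive form (L : Type) : Type :=
| Letter (p : L)
| Unit (x : conn)
| Bin (x : conn) (A B : form L).

Arguments Letter {L} p.
Arguments Unit {L} x.
Arguments Bin {L} x A B.

Declare Scope form_scope.
Delimit Scope form_scope with form.
Bind Scope form_scope with form.

Notation "⊤" := (Unit And) : form_scope.
Notation "⊥" := (Unit Or) : form_scope.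
Notation "A ∧ B" := (Bin And A B) (at level 80, right associativity) : form_scope.
Notation "A ∨ B" := (Bin Or A B) (at level 85, right associativity) : form_scope.
Notation "A ⟨ x ⟩ B" := (Bin x A B)
  (at level 50, x at level 200, no associativity) : form_scope.

Local Open Scope form_scope.

Fixpoint letters {L : Type} (A : form L) : list L :=
  match A with
  | Letter p => p :: nil
  | Unit _ => nil
  | Bin _ A1 A2 => letters A1 ++ letters A2
  end.

Definition diversified {L : Type} (A : form L) : Prop := NoDup (letters A).

Definition letterless {L : Type} (A : form L) : Prop :=
  forall p : L, ~ In p (letters A).

Definition conn_eqb (x y : conn) : bool :=
  match x, y with
  | And, And | Or, Or => true
  | _, _ => false
  end.

Definition is_unit {L : Type} (z : conn) (A : form L) : bool :=
  match A with
  | Unit z' => conn_eqb z z'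
  | _ => false
  end.

(* The normal form of [N1 x N2] for [N1], [N2] in normal form.  Once the case
   of two equal constants is excluded, [N1 = Unit x] entails [N2 <> N1]. *)
Definition nu_bin {L : Type} (x : conn) (N1 N2 : form L) : form L :=
  if is_unit And N1 && is_unit And N2 then ⊤
  else if is_unit Or N1 && is_unit Or N2 then ⊥
  else if is_unit x N1 then N2
  else if is_unit x N2 then N1
  else N1 ⟨x⟩ N2.

Fixpoint nu {L : Type} (A : form L) : form L :=
  match A with
  | Letter p => Letter p
  | Unit z => Unit z
  | Bin x A1 A2 => nu_bin x (nu A1) (nu A2)
  end.

Fixpoint unit_occurs {L : Type} (A : form L) : Prop :=
  match A with
  | Letter _ => False
  | Unit _ => True
  | Bin _ A1 A2 => unit_occurs A1 \/ unit_occurs A2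
  end.

Definition pure {L : Type} (A : form L) : Prop := ~ unit_occurs (nu A).

(* The final [R] and [L] of a name stand for the superscript arrows -> and <-.
   The argument [x] selects the hatted ([And]) or checked ([Or]) version. *)
Inductive term {L : Type} : form L -> form L -> Type :=
| Id A : term A A
| Comp A B C (g : term B C) (f : term A B) : term A C
| Par x A B A' B' (f : term A B) (g : term A' B') : term (A ⟨x⟩ A') (B ⟨x⟩ B')
| bR x A B C : term (A ⟨x⟩ (B ⟨x⟩ C)) ((A ⟨x⟩ B) ⟨x⟩ C)
| bL x A B C : term ((A ⟨x⟩ B) ⟨x⟩ C) (A ⟨x⟩ (B ⟨x⟩ C))
| c x A B : term (A ⟨x⟩ B) (B ⟨x⟩ A)
| deltaR x A : term (A ⟨x⟩ Unit x) A
| deltaL x A : term A (A ⟨x⟩ Unit x)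
| sigmaR x A : term (Unit x ⟨x⟩ A) A
| sigmaL x A : term A (Unit x ⟨x⟩ A)
| wbotL : term ⊥ (⊥ ∧ ⊥)
| wbotR : term (⊥ ∧ ⊥) ⊥
| wtopR : term (⊤ ∨ ⊤) ⊤
| wtopL : term ⊤ (⊤ ∨ ⊤)
| kappa : term ⊥ ⊤
| ck A B C D : term ((A ∧ B) ∨ (C ∧ D)) ((A ∨ C) ∧ (B ∨ D)).

Arguments Id {L} A.
Arguments Comp {L A B C} g f.
Arguments Par {L} x {A B A' B'} f g.
Arguments bR {L} x A B C.
Arguments bL {L} x A B C.
Arguments c {L} x A B.
Arguments deltaR {L} x A.
Arguments deltaL {L} x A.
Arguments sigmaR {L} x A.
Arguments sigmaL {L} x A.
Arguments wbotL {L}.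
Arguments wbotR {L}.
Arguments wtopR {L}.
Arguments wtopL {L}.
Arguments kappa {L}.
Arguments ck {L} A B C D.

Declare Scope term_scope.
Delimit Scope term_scope with term.
Bind Scope term_scope with term.

Notation "g ∘ f" := (Comp g f) (at level 40, left associativity) : term_scope.
Notation "f ∧ g" := (Par And f g) (at level 80, right associativity) : term_scope.
Notation "f ∨ g" := (Par Or f g) (at level 85, right associativity) : term_scope.
Notation "f ⟨ x ⟩ g" := (Par x f g)
  (at level 50, x at level 200, no associativity) : term_scope.

Local Open Scope term_scope.

Reserved Notation "f ≡ g" (at level 90, no associativity).

Inductive eqt {L : Type} : forall A B : form L, term A B -> term A B -> Prop :=
| eqt_refl A B (f : term A B) : f ≡ f
| eqt_sym A B (f g : term A B) : f ≡ g -> g ≡ f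
| eqt_trans A B (f g h : term A B) : f ≡ g -> g ≡ h -> f ≡ h
| eqt_comp A B C (g g' : term B C) (f f' : term A B) :
    g ≡ g' -> f ≡ f' -> g ∘ f ≡ g' ∘ f'
| eqt_par x A B A' B' (f g : term A B) (f' g' : term A' B') :
    f ≡ g -> f' ≡ g' -> f ⟨x⟩ f' ≡ g ⟨x⟩ g'
| eqt_id_l A B (f : term A B) : Id B ∘ f ≡ f
| eqt_id_r A B (f : term A B) : f ∘ Id A ≡ f
| eqt_assoc A B C D (h : term C D) (g : term B C) (f : term A B) :
    h ∘ (g ∘ f) ≡ (h ∘ g) ∘ f
| eqt_par_id x A B : Id A ⟨x⟩ Id B ≡ Id (A ⟨x⟩ B)
| eqt_par_comp x A B C A' B' C'
    (g : term B C) (f : term A B) (g' : term B' C') (f' : term A' B') :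
    (g ∘ f) ⟨x⟩ (g' ∘ f') ≡ (g ⟨x⟩ g') ∘ (f ⟨x⟩ f')
(* Naturality of [bL], [deltaL] and [sigmaL] is not listed: it follows, as
   they are inverses of [bR], [deltaR] and [sigmaR]. *)
| eqt_b_nat x A B C A' B' C' (f : term A A') (g : term B B') (h : term C C') :
    bR x A' B' C' ∘ (f ⟨x⟩ (g ⟨x⟩ h)) ≡ ((f ⟨x⟩ g) ⟨x⟩ h) ∘ bR x A B C
| eqt_c_nat x A B A' B' (f : term A A') (g : term B B') :
    c x A' B' ∘ (f ⟨x⟩ g) ≡ (g ⟨x⟩ f) ∘ c x A B
| eqt_delta_nat x A A' (f : term A A') :
    deltaR x A' ∘ (f ⟨x⟩ Id (Unit x)) ≡ f ∘ deltaR x A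
| eqt_sigma_nat x A A' (f : term A A') :
    sigmaR x A' ∘ (Id (Unit x) ⟨x⟩ f) ≡ f ∘ sigmaR x A
| eqt_ck_nat A B C D A' B' C' D'
    (f : term A A') (g : term B B') (h : term C C') (k : term D D') :
    ck A' B' C' D' ∘ ((f ∧ g) ∨ (h ∧ k)) ≡ ((f ∨ h) ∧ (g ∨ k)) ∘ ck A B C D
| eqt_bLR x A B C : bL x A B C ∘ bR x A B C ≡ Id (A ⟨x⟩ (B ⟨x⟩ C))
| eqt_bRL x A B C : bR x A B C ∘ bL x A B C ≡ Id ((A ⟨x⟩ B) ⟨x⟩ C)
| eqt_cc x A B : c x B A ∘ c x A B ≡ Id (A ⟨x⟩ B)
| eqt_deltaLR x A : deltaL x A ∘ deltaR x A ≡ Id (A ⟨x⟩ Unit x)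
| eqt_deltaRL x A : deltaR x A ∘ deltaL x A ≡ Id A
| eqt_sigmaLR x A : sigmaL x A ∘ sigmaR x A ≡ Id (Unit x ⟨x⟩ A)
| eqt_sigmaRL x A : sigmaR x A ∘ sigmaL x A ≡ Id A
| eqt_wbotLR : wbotL ∘ wbotR ≡ Id (⊥ ∧ ⊥)
| eqt_wbotRL : wbotR ∘ wbotL ≡ Id ⊥
| eqt_wtopLR : wtopL ∘ wtopR ≡ Id (⊤ ∨ ⊤)
| eqt_wtopRL : wtopR ∘ wtopL ≡ Id ⊤
| eqt_pentagon x A B C D :
    bR x (A ⟨x⟩ B) C D ∘ bR x A B (C ⟨x⟩ D)
    ≡ (bR x A B C ⟨x⟩ Id D) ∘ bR x A (B ⟨x⟩ C) D ∘ (Id A ⟨x⟩ bR x B C D)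
| eqt_hexagon x A B C :
    c x A (B ⟨x⟩ C)
    ≡ bR x B C A ∘ (Id B ⟨x⟩ c x A C) ∘ bL x B A C ∘ (c x A B ⟨x⟩ Id C)
      ∘ bR x A B C
| eqt_delta_sigma x : deltaR x (Unit x) ≡ sigmaR x (Unit x)
| eqt_b_unit x A C : bR x A (Unit x) C ≡ deltaL x A ⟨x⟩ sigmaR x C
| eqt_wtop_b :
    wtopR ∘ (wtopR ∨ Id ⊤) ∘ bR Or ⊤ ⊤ ⊤ ≡ wtopR ∘ (Id ⊤ ∨ wtopR)
| eqt_wbot_b :
    bL And ⊥ ⊥ ⊥ ∘ (wbotL ∧ Id ⊥) ∘ wbotL ≡ (Id ⊥ ∧ wbotL) ∘ wbotL
| eqt_wtop_c : wtopR ∘ c Or ⊤ ⊤ ≡ wtopR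
| eqt_wbot_c : c And ⊥ ⊥ ∘ wbotL ≡ wbotL
| eqt_kappa_wtop_delta : deltaR Or ⊤ ≡ wtopR ∘ (Id ⊤ ∨ kappa)
| eqt_kappa_wtop_sigma : sigmaR Or ⊤ ≡ wtopR ∘ (kappa ∨ Id ⊤)
| eqt_kappa_wbot_delta : deltaL And ⊥ ≡ (Id ⊥ ∧ kappa) ∘ wbotL
| eqt_kappa_wbot_sigma : sigmaL And ⊥ ≡ (kappa ∧ Id ⊥) ∘ wbotL
| eqt_ck_bOr A1 A2 A3 A1' A2' A3' :
    ck (A1 ∨ A2) (A1' ∨ A2') A3 A3' ∘ (ck A1 A1' A2 A2' ∨ Id (A3 ∧ A3'))
      ∘ bR Or (A1 ∧ A1') (A2 ∧ A2') (A3 ∧ A3')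
    ≡ (bR Or A1 A2 A3 ∧ bR Or A1' A2' A3') ∘ ck A1 A1' (A2 ∨ A3) (A2' ∨ A3')
      ∘ (Id (A1 ∧ A1') ∨ ck A2 A2' A3 A3')
| eqt_ck_bAnd A1 A2 A3 A1' A2' A3' :
    bL And (A1 ∨ A1') (A2 ∨ A2') (A3 ∨ A3')
      ∘ (ck A1 A2 A1' A2' ∧ Id (A3 ∨ A3')) ∘ ck (A1 ∧ A2) A3 (A1' ∧ A2') A3'
    ≡ (Id (A1 ∨ A1') ∧ ck A2 A3 A2' A3') ∘ ck A1 (A2 ∧ A3) A1' (A2' ∧ A3')
      ∘ (bL And A1 A2 A3 ∨ bL And A1' A2' A3')
| eqt_ck_cOr A1 A2 A1' A2' :
    ck A2 A2' A1 A1' ∘ c Or (A1 ∧ A1') (A2 ∧ A2')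
    ≡ (c Or A1 A2 ∧ c Or A1' A2') ∘ ck A1 A1' A2 A2'
| eqt_ck_cAnd A1 A2 A1' A2' :
    c And (A1 ∨ A1') (A2 ∨ A2') ∘ ck A1 A2 A1' A2'
    ≡ ck A2 A1 A2' A1' ∘ (c And A1 A2 ∨ c And A1' A2')
| eqt_ck_deltaOr A A' :
    deltaR Or (A ∧ A')
    ≡ (deltaR Or A ∧ deltaR Or A') ∘ ck A A' ⊥ ⊥ ∘ (Id (A ∧ A') ∨ wbotL)
| eqt_ck_sigmaOr A A' :
    sigmaR Or (A ∧ A')
    ≡ (sigmaR Or A ∧ sigmaR Or A') ∘ ck ⊥ ⊥ A A' ∘ (wbotL ∨ Id (A ∧ A'))
| eqt_ck_deltaAnd A A' :
    deltaL And (A ∨ A')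
    ≡ (Id (A ∨ A') ∧ wtopR) ∘ ck A ⊤ A' ⊤ ∘ (deltaL And A ∨ deltaL And A')
| eqt_ck_sigmaAnd A A' :
    sigmaL And (A ∨ A')
    ≡ (wtopR ∧ Id (A ∨ A')) ∘ ck ⊤ A ⊤ A' ∘ (sigmaL And A ∨ sigmaL And A')
| eqt_ck_kappa1 :
    deltaR And ⊤ ∘ (deltaR Or ⊤ ∧ sigmaR Or ⊤) ∘ ck ⊤ ⊥ ⊥ ⊤
    ≡ kappa ∘ deltaR Or ⊥ ∘ (sigmaR And ⊥ ∨ deltaR And ⊥)
| eqt_ck_kappa2 :
    deltaR And ⊤ ∘ (sigmaR Or ⊤ ∧ deltaR Or ⊤) ∘ ck ⊥ ⊤ ⊤ ⊥
    ≡ kappa ∘ deltaR Or ⊥ ∘ (deltaR And ⊥ ∨ sigmaR And ⊥)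
where "f ≡ g" := (eqt f g) : term_scope.

(* An arrow of the free category is an equivalence class of arrow terms,
   represented by its membership predicate. *)
Record arrow {L : Type} (A B : form L) : Type := Arrow {
  arrow_class : term A B -> Prop;
  arrow_classP : exists t : term A B, arrow_class = eqt t
}.

(* Main.v *)
From Stdlib Require Import List Permutation Setoid Morphisms Wf_nat Lia.
From Stdlib Require Import Program.Equality Classical ClassicalEpsilon.
From Stdlib Require Import FunctionalExtensionality PropExtensionality ProofIrrelevance.
Require Import Defs.

(* Every formula [A] is isomorphic to [nu A], and the arrows between formulae
   whose normal forms are a letter or a constant are computed directly: up to
   these isomorphisms they are identities or [kappa].  This settles the
   letterless case and the arrows from a letter to a letter.

   For pure formulae the main tool is a natural transformation
   [A -> A[s] ∧ A[t]], where [s] and [t] replace complementary sets of letters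
   by [⊤]; on disjunctions it is [c^k] and on conjunctions the middle exchange.
   If [B = B1 ∧ B2] and [s], [t] keep the letters of [B1] and of [B2]
   respectively, its component at [B] is split mono, so that [f : A -> B] is
   determined by [f[s]] and [f[t]], which have fewer letters.  Their sources are
   pure again, as follows from two invariants of arrows: truth values, and the
   fact that two letters joined by [∧] in the source are so in the target.
   Dually, an arrow out of [A1 ∨ A2] is determined by two smaller arrows.  There
   is no arrow from a conjunction of pure formulae to a disjunction. *)

Set Implicit Arguments.
Unset Strict Implicit.
Unset Printing Implicit Defensive.

Local Open Scope form_scope.
Local Open Scope term_scope.

(** * Monoidal coherence and the middle exchange *)

#[local] Instance eqt_equiv {L} (A B : form L) : Equivalence (@eqt L A B).
Proof.
  split; [exact (@eqt_refl L A B) | exact (@eqt_sym L A B) | exact (@eqt_trans L A B)].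
Qed.

#[local] Instance comp_proper {L} (A B C : form L) :
  Proper (@eqt L B C ==> @eqt L A B ==> @eqt L A C) Comp.
Proof. intros g g' Hg f f' Hf; apply eqt_comp; assumption. Qed.

#[local] Instance par_proper {L} x (A B A' B' : form L) :
  Proper (@eqt L A B ==> @eqt L A' B' ==> @eqt L (Bin x A A') (Bin x B B')) (Par x).
Proof. intros g g' Hg f f' Hf; apply eqt_par; assumption. Qed.

(** Composites are kept right-associated, so a composite that is the left side of an equation is
    rarely a subterm of the goal. With a trailing arrow [k], as here and in [compl3_eqt], it becomes
    one; [rw] tries these forms before plain rewriting. *)
Lemma compl_eqt {L} (A B C D : form L) (g : term B C) (f : term A B) (h : term A C)
    (e : g ∘ f ≡ h) (k : term D A) : g ∘ (f ∘ k) ≡ h ∘ k.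
Proof. rewrite eqt_assoc, e; reflexivity. Qed.

Lemma compl3_eqt {L} (A B C D E : form L) (g : term C D) (f : term B C) (f' : term A B)
    (h : term A D) (e : g ∘ (f ∘ f') ≡ h) (k : term E A) :
  g ∘ (f ∘ (f' ∘ k)) ≡ h ∘ k.
Proof. rewrite <- e, <- !eqt_assoc; reflexivity. Qed.

Ltac ra := rewrite <- ?eqt_assoc.
Tactic Notation "rw" uconstr(e) :=
  first [rewrite (compl3_eqt e) | rewrite (compl_eqt e) | rewrite e]; ra.
Ltac ids := rewrite ?eqt_par_id, ?eqt_id_l, ?eqt_id_r, ?eqt_par_id.

Lemma par_comp {L} x (A B C A' B' C' : form L)
    (g : term B C) (f : term A B) (g' : term B' C') (f' : term A' B') :
  (g ⟨x⟩ g') ∘ (f ⟨x⟩ f') ≡ (g ∘ f) ⟨x⟩ (g' ∘ f').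
Proof. symmetry; apply eqt_par_comp. Qed.

Lemma par_comp_l {L} x (A B C D : form L) (g : term B C) (f : term A B) :
  (g ∘ f) ⟨x⟩ Id D ≡ (g ⟨x⟩ Id D) ∘ (f ⟨x⟩ Id D).
Proof. rewrite par_comp; ids; reflexivity. Qed.

Lemma par_comp_r {L} x (A B C D : form L) (g : term B C) (f : term A B) :
  Id D ⟨x⟩ (g ∘ f) ≡ (Id D ⟨x⟩ g) ∘ (Id D ⟨x⟩ f).
Proof. rewrite par_comp; ids; reflexivity. Qed.

Lemma par_lr {L} x (A B A' B' : form L) (f : term A B) (g : term A' B') :
  f ⟨x⟩ g ≡ (f ⟨x⟩ Id B') ∘ (Id A ⟨x⟩ g).
Proof. rewrite par_comp; ids; reflexivity. Qed.

Lemma par_rl {L} x (A B A' B' : form L) (f : term A B) (g : term A' B') :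
  f ⟨x⟩ g ≡ (Id B ⟨x⟩ g) ∘ (f ⟨x⟩ Id A').
Proof. rewrite par_comp; ids; reflexivity. Qed.

Lemma cancel_l {L} (A B C : form L) (i : term B C) (j : term C B) (f g : term A B) :
  j ∘ i ≡ Id B -> i ∘ f ≡ i ∘ g -> f ≡ g.
Proof.
  intros H E. rewrite <- (eqt_id_l f), <- (eqt_id_l g), <- H. ra.
  rewrite E; reflexivity.
Qed.

Lemma cancel_r {L} (A B C : form L) (i : term A B) (j : term B A) (f g : term B C) :
  i ∘ j ≡ Id B -> f ∘ i ≡ g ∘ i -> f ≡ g.
Proof.
  intros H E. rewrite <- (eqt_id_r f), <- (eqt_id_r g), <- H.
  rewrite !eqt_assoc, E; reflexivity.
Qed.

(** Serves to pass from naturality of an isomorphism to naturality of its inverse. *)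
Lemma square_inv {L} (A B C D : form L) (i : term A B) (i' : term B A)
    (j : term C D) (j' : term D C) (f : term A C) (g : term B D) :
  i ∘ i' ≡ Id B -> j' ∘ j ≡ Id C -> j ∘ f ≡ g ∘ i -> f ∘ i' ≡ j' ∘ g.
Proof.
  intros Hi Hj E. rewrite <- (eqt_id_r g), <- Hi. rw (eqt_sym E).
  rw Hj. ids. reflexivity.
Qed.

Lemma bL_nat {L} x (A B C A' B' C' : form L)
    (f : term A A') (g : term B B') (h : term C C') :
  bL x A' B' C' ∘ ((f ⟨x⟩ g) ⟨x⟩ h) ≡ (f ⟨x⟩ (g ⟨x⟩ h)) ∘ bL x A B C.
Proof.
  symmetry. eapply square_inv; [apply eqt_bRL | apply eqt_bLR | apply eqt_b_nat].
Qed.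

Lemma par_inv {L} x (A B A' B' : form L) (f : term A B) (f' : term B A)
    (g : term A' B') (g' : term B' A') :
  f ∘ f' ≡ Id B -> g ∘ g' ≡ Id B' -> (f ⟨x⟩ g) ∘ (f' ⟨x⟩ g') ≡ Id (B ⟨x⟩ B').
Proof. intros H H'. rewrite par_comp, H, H', eqt_par_id; reflexivity. Qed.

(** Here and in the next two lemmas some sides of the pentagon are inverted, to the shapes in which
    [gam] meets associativity. *)
Lemma pentagon1 {L} x (A B C D : form L) :
  bL x A B (C ⟨x⟩ D) ∘ (bL x (A ⟨x⟩ B) C D ∘ (bR x A B C ⟨x⟩ Id D))
  ≡ (Id A ⟨x⟩ bL x B C D) ∘ bL x A (B ⟨x⟩ C) D.
Proof.
  apply (cancel_r (i := bR x A (B ⟨x⟩ C) D ∘ (Id A ⟨x⟩ bR x B C D))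
     (j := (Id A ⟨x⟩ bL x B C D) ∘ bL x A (B ⟨x⟩ C) D)).
  - ra. rw (par_inv x (eqt_id_l (Id A)) (eqt_bRL x B C D)). ids. apply eqt_bRL.
  - ra. pose proof (eqt_pentagon x A B C D) as P. rewrite <- eqt_assoc in P.
    rw (eqt_sym P). rw (eqt_bLR x (A ⟨x⟩ B) C D). ids. rewrite eqt_bLR.
    rw (eqt_bLR x A (B ⟨x⟩ C) D). ids.
    rewrite (par_inv x (eqt_id_l (Id A)) (eqt_bLR x B C D)). reflexivity.
Qed.

Lemma pentagon2 {L} x (A B C D : form L) :
  bL x A (B ⟨x⟩ C) D ∘ (bL x A B C ⟨x⟩ Id D)
  ≡ (Id A ⟨x⟩ bR x B C D) ∘ (bL x A B (C ⟨x⟩ D) ∘ bL x (A ⟨x⟩ B) C D).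
Proof.
  apply (cancel_r (i := bR x A B C ⟨x⟩ Id D) (j := bL x A B C ⟨x⟩ Id D)).
  - apply par_inv; [apply eqt_bRL | apply eqt_id_l].
  - ra. rewrite pentagon1. rewrite (par_inv x (eqt_bLR x A B C) (eqt_id_l (Id D))).
    rw (par_inv x (eqt_id_l (Id A)) (eqt_bRL x B C D)). ids. reflexivity.
Qed.

Lemma pentagon3 {L} x (A B C D : form L) :
  bL x (A ⟨x⟩ B) C D ∘ ((bR x A B C ⟨x⟩ Id D) ∘ bR x A (B ⟨x⟩ C) D)
  ≡ bR x A B (C ⟨x⟩ D) ∘ (Id A ⟨x⟩ bL x B C D).
Proof.
  apply (cancel_l (i := bL x A B (C ⟨x⟩ D)) (j := bR x A B (C ⟨x⟩ D))).
  - apply eqt_bRL.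
  - rw (eqt_bLR x A B (C ⟨x⟩ D)). ids.
    rewrite !eqt_assoc. rewrite <- (eqt_assoc (bL x A B _)), pentagon1. ra.
    rewrite eqt_bLR. ids. reflexivity.
Qed.

(** If [A ⟨x⟩ -] is read as an action of [A] on objects, this arrow exchanges two successive
    actions. *)
Definition gam {L} x (A B X : form L) : term (A ⟨x⟩ (B ⟨x⟩ X)) (B ⟨x⟩ (A ⟨x⟩ X)) :=
  bL x B A X ∘ ((c x A B ⟨x⟩ Id X) ∘ bR x A B X).

Lemma gam_nat {L} x (A B X A' B' X' : form L)
    (f : term A A') (g : term B B') (h : term X X') :
  gam x A' B' X' ∘ (f ⟨x⟩ (g ⟨x⟩ h)) ≡ (g ⟨x⟩ (f ⟨x⟩ h)) ∘ gam x A B X.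
Proof.
  unfold gam. ra. rewrite eqt_b_nat. rw (par_comp x (c x A' B') (f ⟨x⟩ g) (Id X') h).
  rewrite eqt_c_nat, eqt_id_l, <- (eqt_id_r h), eqt_par_comp. ra.
  rw (bL_nat x g f h). ids. reflexivity.
Qed.

Lemma gam_inv {L} x (A B X : form L) : gam x B A X ∘ gam x A B X ≡ Id _.
Proof.
  unfold gam. ra. rw (eqt_bRL x B A X). ids.
  rw (par_inv x (eqt_cc x A B) (eqt_id_l (Id X))). ids. apply eqt_bLR.
Qed.

(** The hexagon in action form: [A] passes [B ⟨x⟩ C] by passing [B] first and then [C]. *)
Lemma gam_hexagon_r {L} x (A B C X : form L) :
  bL x B C (A ⟨x⟩ X) ∘ gam x A (B ⟨x⟩ C) X
  ≡ (Id B ⟨x⟩ gam x A C X) ∘ (gam x A B (C ⟨x⟩ X) ∘ (Id A ⟨x⟩ bL x B C X)).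
Proof.
  unfold gam. rewrite eqt_hexagon, !par_comp_l, !par_comp_r. ra.
  rw (pentagon1 x B C A X).
  rw (bL_nat x (Id B) (c x A C) (Id X)).
  rw (pentagon2 x B A C X).
  rw (bL_nat x (c x A B) (Id C) (Id X)).
  rewrite pentagon3. ids. reflexivity.
Qed.

(** This is the previous hexagon with all exchanges inverted, as [gam x B A X] is inverse to
    [gam x A B X]. *)
Lemma gam_hexagon_l {L} x (A B C X : form L) :
  (Id C ⟨x⟩ bL x A B X) ∘ gam x (A ⟨x⟩ B) C X
  ≡ gam x A C (B ⟨x⟩ X) ∘ ((Id A ⟨x⟩ gam x B C X) ∘ bL x A B (C ⟨x⟩ X)).
Proof.
  pose proof (gam_hexagon_r x C A B X) as H.
  assert (E : bL x A B (C ⟨x⟩ X)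
     ≡ (Id A ⟨x⟩ gam x C B X) ∘ (gam x C A (B ⟨x⟩ X)
        ∘ ((Id C ⟨x⟩ bL x A B X) ∘ gam x (A ⟨x⟩ B) C X))).
  { rewrite <- (eqt_id_r (bL x A B (C ⟨x⟩ X))), <- (gam_inv x (A ⟨x⟩ B) C X).
    rw H. reflexivity. }
  rewrite E. rw (par_inv x (eqt_id_l (Id A)) (gam_inv x C B (X))). ids.
  rw (gam_inv x C A (B ⟨x⟩ X)). ids. reflexivity.
Qed.

(* Strictification: [act x t] replaces [fm x t ⟨x⟩ -] by an iterated action
   of the leaves of [t], under which the associativity arrows become identities
   and a symmetry becomes a composite of the [gam]s. *)
Inductive tree (L : Type) : Type :=
| At (A : form L)
| Br (s t : tree L).
Arguments At {L} A.
Arguments Br {L} s t.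

Fixpoint fm {L} x (t : tree L) : form L :=
  match t with At A => A | Br s t => fm x s ⟨x⟩ fm x t end.

Fixpoint act {L} x (t : tree L) (X : form L) : form L :=
  match t with At A => A ⟨x⟩ X | Br s t => act x s (act x t X) end.

Fixpoint actm {L} x (t : tree L) (X Y : form L) (f : term X Y) :
    term (act x t X) (act x t Y) :=
  match t with
  | At A => Id A ⟨x⟩ f
  | Br s t => actm x s (actm x t f)
  end.

Fixpoint alpha {L} x (t : tree L) (X : form L) : term (fm x t ⟨x⟩ X) (act x t X) :=
  match t with
  | At A => Id _
  | Br s t => actm x s (alpha x t X) ∘ (alpha x s (fm x t ⟨x⟩ X) ∘ bL x (fm x s) (fm x t) X)
  end.

Fixpoint alphaI {L} x (t : tree L) (X : form L) : term (act x t X) (fm x t ⟨x⟩ X) :=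
  match t with
  | At A => Id _
  | Br s t => bR x (fm x s) (fm x t) X ∘ (alphaI x s (fm x t ⟨x⟩ X) ∘ actm x s (alphaI x t X))
  end.

#[local] Instance actm_proper {L} x (t : tree L) (X Y : form L) :
  Proper (@eqt L X Y ==> @eqt L (act x t X) (act x t Y)) (@actm L x t X Y).
Proof.
  intros f g E. revert X Y f g E. induction t; intros; simpl.
  - rewrite E; reflexivity.
  - apply IHt1, IHt2, E.
Qed.

Lemma actm_id {L} x (t : tree L) (X : form L) : actm x t (Id X) ≡ Id _.
Proof.
  revert X; induction t; intros; simpl; [apply eqt_par_id | rewrite IHt2; apply IHt1].
Qed.

Lemma actm_comp {L} x (t : tree L) (X Y Z : form L) (g : term Y Z) (f : term X Y) :
  actm x t (g ∘ f) ≡ actm x t g ∘ actm x t f.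
Proof.
  revert X Y Z g f; induction t; intros; simpl; [apply par_comp_r | rewrite IHt2; apply IHt1].
Qed.

Lemma alpha_nat {L} x (t : tree L) (X Y : form L) (f : term X Y) :
  alpha x t Y ∘ (Id _ ⟨x⟩ f) ≡ actm x t f ∘ alpha x t X.
Proof.
  revert X Y f; induction t as [A | s IHs t IHt]; intros; simpl.
  - ids; reflexivity.
  - ra. rewrite <- (eqt_par_id x). rewrite bL_nat. rw (IHs _ _ (Id (fm x t) ⟨x⟩ f)).
    rewrite !eqt_assoc, <- !actm_comp, IHt. reflexivity.
Qed.

Lemma alphaI_alpha {L} x (t : tree L) (X : form L) : alphaI x t X ∘ alpha x t X ≡ Id _.
Proof.
  revert X; induction t as [A | s IHs t IHt]; intros; simpl.
  - ids; reflexivity.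
  - ra. rw (eqt_sym (actm_comp x s (alphaI x t X) (alpha x t X))).
    rewrite IHt, actm_id. ids. rw (IHs (Bin x (fm x t) X)). ids. apply eqt_bRL.
Qed.

Lemma alpha_alphaI {L} x (t : tree L) (X : form L) : alpha x t X ∘ alphaI x t X ≡ Id _.
Proof.
  revert X; induction t as [A | s IHs t IHt]; intros; simpl.
  - ids; reflexivity.
  - ra. rw (eqt_bLR x (fm x s) (fm x t) X). ids. rw (IHs (Bin x (fm x t) X)). ids.
    rewrite <- actm_comp, IHt. apply actm_id.
Qed.

Fixpoint swA {L} x (A : form L) (t : tree L) (X : form L) :
    term (A ⟨x⟩ act x t X) (act x t (A ⟨x⟩ X)) :=
  match t with
  | At B => gam x A B X
  | Br t1 t2 => actm x t1 (swA x A t2 X) ∘ swA x A t1 (act x t2 X)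
  end.

Fixpoint sw {L} x (s t : tree L) (X : form L) :
    term (act x s (act x t X)) (act x t (act x s X)) :=
  match s with
  | At A => swA x A t X
  | Br s1 s2 => sw x s1 t (act x s2 X) ∘ actm x s1 (sw x s2 t X)
  end.

Lemma swA_nat {L} x (A : form L) t (X Y : form L) (f : term X Y) :
  swA x A t Y ∘ (Id A ⟨x⟩ actm x t f) ≡ actm x t (Id A ⟨x⟩ f) ∘ swA x A t X.
Proof.
  revert X Y f; induction t as [B | s IHs t IHt]; intros; simpl.
  - apply gam_nat.
  - ra. rewrite IHs. rw (eqt_sym (actm_comp x s (swA x A t Y) (Id A ⟨x⟩ actm x t f))).
    rewrite IHt, actm_comp. ra. reflexivity.
Qed.

Lemma sw_nat {L} x (s t : tree L) (X Y : form L) (f : term X Y) :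
  sw x s t Y ∘ actm x s (actm x t f) ≡ actm x t (actm x s f) ∘ sw x s t X.
Proof.
  revert X Y f; induction s as [B | s1 IHs s2 IHt]; intros; simpl.
  - apply swA_nat.
  - ra. rewrite <- actm_comp, IHt, actm_comp. rw (IHs _ _ (actm x s2 f)). reflexivity.
Qed.

(** [F] is the strict form of [f]. By [rep_eq] it determines [f], so an equation between arrows made
    of associativity, symmetry and unit arrows can be checked on strict forms, where associativity
    has become the identity. *)
Definition rep {L} x (s t : tree L) (f : term (fm x s) (fm x t))
    (F : forall X, term (act x s X) (act x t X)) : Prop :=
  forall X, alpha x t X ∘ (f ⟨x⟩ Id X) ≡ F X ∘ alpha x s X.

(** Conjugation by the isomorphisms [alpha] turns [F] into [f ⟨x⟩ Id], and this is natural by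
    functoriality. *)
Lemma rep_nat {L} x (s t : tree L) (f : term (fm x s) (fm x t)) F (X Y : form L)
    (h : term X Y) :
  rep f F -> F Y ∘ actm x s h ≡ actm x t h ∘ F X.
Proof.
  intros H. apply (cancel_r (alpha_alphaI x s X)). ra.
  rewrite <- alpha_nat. rw (eqt_sym (H Y)). rewrite <- (H X).
  rewrite <- par_lr. rw (eqt_sym (alpha_nat x t h)). rewrite <- par_rl. reflexivity.
Qed.

Lemma rep_ext {L} x (s t : tree L) (f : term (fm x s) (fm x t)) F G :
  rep f F -> (forall X, F X ≡ G X) -> rep f G.
Proof. intros H E X. rewrite <- E. apply H. Qed.

Lemma rep_id {L} x (s : tree L) : rep (s := s) (t := s) (Id (fm x s)) (fun X => Id _).
Proof. intros X. ids. reflexivity. Qed.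

Lemma rep_comp {L} x (s t u : tree L) (g : term (fm x t) (fm x u))
    (f : term (fm x s) (fm x t)) G F :
  rep g G -> rep f F -> rep (g ∘ f) (fun X => G X ∘ F X).
Proof.
  intros HG HF X. rewrite par_comp_l. rw (HG X). rewrite (HF X). reflexivity.
Qed.

Lemma rep_par {L} x (s t s' t' : tree L) (f : term (fm x s) (fm x t))
    (g : term (fm x s') (fm x t')) F G :
  rep f F -> rep g G ->
  rep (s := Br s s') (t := Br t t') (f ⟨x⟩ g) (fun X => F (act x t' X) ∘ actm x s (G X)).
Proof.
  intros HF HG X. simpl. ra. rewrite bL_nat. rw (par_rl x f (g ⟨x⟩ Id X)).
  rw (alpha_nat x t (g ⟨x⟩ Id X)). rw (HF (Bin x (fm x s') X)).
  rw (eqt_sym (actm_comp x t (alpha x t' X) (g ⟨x⟩ Id X))).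
  rewrite (HG X). rw (eqt_sym (rep_nat (G X ∘ alpha x s' X) HF)).
  rewrite actm_comp. ra. reflexivity.
Qed.

Lemma rep_bR {L} x (s t u : tree L) :
  rep (s := Br s (Br t u)) (t := Br (Br s t) u) (bR x (fm x s) (fm x t) (fm x u))
    (fun X => Id _).
Proof.
  intros X. simpl. ids. ra. rewrite pentagon1.
  rw (alpha_nat x s (bL x (fm x t) (fm x u) X)).
  rewrite !actm_comp. ra. reflexivity.
Qed.

Lemma rep_bL {L} x (s t u : tree L) :
  rep (s := Br (Br s t) u) (t := Br s (Br t u)) (bL x (fm x s) (fm x t) (fm x u))
    (fun X => Id _).
Proof.
  intros X. pose proof (rep_bR x s t u X) as H. rewrite eqt_id_l in *.
  rewrite <- H. ra. cbn [fm]. rewrite (par_inv x (eqt_bRL x _ _ _) (eqt_id_l (Id X))). ids.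
  reflexivity.
Qed.

Lemma gam_swA {L} x A (t : tree L) (X : form L) :
  alpha x t (A ⟨x⟩ X) ∘ gam x A (fm x t) X ≡ swA x A t X ∘ (Id A ⟨x⟩ alpha x t X).
Proof.
  revert X; induction t as [B | s IHs t IHt]; intros X; simpl.
  - ids; reflexivity.
  - ra. rewrite gam_hexagon_r. rw (alpha_nat x s (gam x A (fm x t) X)).
    rw (eqt_sym (actm_comp x s (alpha x t (Bin x A X)) (gam x A (fm x t) X))).
    rewrite (IHt X), actm_comp. ra. rw (IHs (Bin x (fm x t) X)).
    rw (eqt_sym (swA_nat x A s (alpha x t X))).
    rewrite !par_comp_r. ra. reflexivity.
Qed.

(** Induction on [s] with [gam_hexagon_l]. The leaf case is [gam_swA], itself an induction on [t]
    with [gam_hexagon_r]. *)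
Lemma gam_sw {L} x (s t : tree L) (X : form L) :
  actm x t (alpha x s X) ∘ (alpha x t (fm x s ⟨x⟩ X) ∘ gam x (fm x s) (fm x t) X)
  ≡ sw x s t X ∘ (actm x s (alpha x t X) ∘ alpha x s (fm x t ⟨x⟩ X)).
Proof.
  revert X; induction s as [B | s1 IHs1 s2 IHs2]; intros X; simpl.
  - rewrite actm_id. ids. apply gam_swA.
  - rewrite !actm_comp. ra.
    rw (eqt_sym (alpha_nat x t (bL x (fm x s1) (fm x s2) X))).
    rewrite gam_hexagon_l. cbn [fm act]. rw (IHs1 (Bin x (fm x s2) X)).
    rw (eqt_sym (sw_nat x s1 t (alpha x s2 X))).
    rw (alpha_nat x s1 (gam x (fm x s2) (fm x t) X)).
    rw (eqt_sym (actm_comp x s1 (alpha x t (Bin x (fm x s2) X)) (gam x (fm x s2) (fm x t) X))).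
    rw (eqt_sym (actm_comp x s1 (actm x t (alpha x s2 X)) (alpha x t (Bin x (fm x s2) X) ∘ gam x (fm x s2) (fm x t) X))).
    rewrite (IHs2 X). rewrite !actm_comp. ra.
    reflexivity.
Qed.

Lemma rep_c {L} x (s t : tree L) :
  rep (s := Br s t) (t := Br t s) (c x (fm x s) (fm x t)) (sw x s t).
Proof.
  intros X; simpl. ra.
  assert (E : bL x (fm x t) (fm x s) X ∘ (c x (fm x s) (fm x t) ⟨x⟩ Id X)
     ≡ gam x (fm x s) (fm x t) X ∘ bL x (fm x s) (fm x t) X).
  { unfold gam. ra. rewrite eqt_bRL. ids. reflexivity. }
  rewrite E. rw (gam_sw x s t X). reflexivity.
Qed.

Lemma unit_par_faithful {L} x (A B : form L) (f g : term A B) :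
  Id (Unit x) ⟨x⟩ f ≡ Id (Unit x) ⟨x⟩ g -> f ≡ g.
Proof.
  intros E. apply (cancel_r (eqt_sigmaRL x A)).
  rewrite <- !eqt_sigma_nat, E. reflexivity.
Qed.

Lemma par_unit_faithful {L} x (A B : form L) (f g : term A B) :
  f ⟨x⟩ Id (Unit x) ≡ g ⟨x⟩ Id (Unit x) -> f ≡ g.
Proof.
  intros E. apply (cancel_r (eqt_deltaRL x A)).
  rewrite <- !eqt_delta_nat, E. reflexivity.
Qed.

(** Kelly's argument: acting by the unit on the left is faithful, and after this action the claim is
    an instance of the pentagon in which [eqt_b_unit] rewrites the associativities that have the
    unit in the middle. *)
Lemma b_unit_l {L} x (A B : form L) :
  (sigmaR x A ⟨x⟩ Id B) ∘ bR x (Unit x) A B ≡ sigmaR x (A ⟨x⟩ B).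
Proof.
  apply (unit_par_faithful (x := x)).
  apply (cancel_l (i := deltaL x (Unit x) ⟨x⟩ Id _) (j := deltaR x (Unit x) ⟨x⟩ Id _)).
  { apply par_inv; [apply eqt_deltaRL | apply eqt_id_l]. }
  apply (cancel_l (eqt_bLR x (Unit x ⟨x⟩ Unit x) A B)).
  rewrite par_comp_r. rewrite <- par_lr. rw (par_comp x (deltaL x (Unit x)) (Id _) (Id _) (sigmaR x A ⟨x⟩ Id B)).
  ids. rw (eqt_b_nat x (deltaL x (Unit x)) (sigmaR x A) (Id B)).
  rewrite <- !eqt_b_unit. rewrite eqt_pentagon. ra. reflexivity.
Qed.

Lemma rep_delta {L} x (s : tree L) :
  rep (s := Br s (At (Unit x))) (t := s) (deltaR x (fm x s))
    (fun X => actm x s (sigmaR x X)).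
Proof.
  intros X; simpl. rewrite actm_id. ids. rw (eqt_sym (alpha_nat x s (sigmaR x X))).
  apply (cancel_r (eqt_bRL x (fm x s) (Unit x) X)). ra.
  rw (eqt_bLR x (fm x s) (Unit x) X). ids. rewrite eqt_b_unit, par_comp.
  rewrite eqt_deltaRL, eqt_id_l. reflexivity.
Qed.

Lemma rep_sigma {L} x (s : tree L) :
  rep (s := Br (At (Unit x)) s) (t := s) (sigmaR x (fm x s))
    (fun X => sigmaR x (act x s X)).
Proof.
  intros X; simpl. ids.
  apply (cancel_r (eqt_bRL x (Unit x) (fm x s) X)). ra.
  rw (eqt_bLR x (Unit x) (fm x s) X). ids. rewrite b_unit_l.
  symmetry; apply eqt_sigma_nat.
Qed.

Lemma rep_eq {L} x (s t : tree L) (f g : term (fm x s) (fm x t)) F G :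
  rep f F -> rep g G -> (forall X, F X ≡ G X) -> f ≡ g.
Proof.
  intros HF HG E.
  apply (par_unit_faithful (x := x)).
  apply (cancel_l (alphaI_alpha x t (Unit x))). rewrite (HF _), (HG _), E. reflexivity.
Qed.

Lemma rep_fun {L} x (s t : tree L) (f g : term (fm x s) (fm x t)) F G :
  rep f F -> rep g G -> f ≡ g -> forall X, F X ≡ G X.
Proof.
  intros HF HG E X. apply (cancel_r (alpha_alphaI x s X)).
  rewrite <- (HF X), <- (HG X), E. reflexivity.
Qed.

Lemma b_unit_r {L} x (A B : form L) :
  (Id A ⟨x⟩ deltaR x B) ∘ bL x A B (Unit x) ≡ deltaR x (A ⟨x⟩ B).
Proof.
  pose (a := At A). pose (b := At B). pose (u := At (Unit x) : tree L).
  refine (rep_eq (s := Br (Br a b) u) (t := Br a b)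
    (rep_comp (t := Br a (Br b u))
      (rep_par (rep_id x a) (rep_delta x b)) (rep_bL x a b u))
    (rep_delta x (Br a b)) _).
  intros X; simpl. ids. reflexivity.
Qed.

(** Compatibility of the symmetry with the units is not among the equations. It comes from
    naturality of [c] at [deltaR x (Unit x)], read on strict forms. *)
Lemma gam_unit {L} x (A X : form L) :
  sigmaR x (A ⟨x⟩ X) ∘ gam x A (Unit x) X ≡ Id A ⟨x⟩ sigmaR x X.
Proof.
  symmetry. apply (unit_par_faithful (x := x)).
  apply (cancel_r (gam_inv x (Unit x) A (Unit x ⟨x⟩ X))).
  pose (a := At A). pose (u := At (Unit x) : tree L).
  pose proof (rep_fun
     (rep_comp (s := Br a (Br u u)) (t := Br a u) (u := Br u a)
        (rep_c x a u) (rep_par (rep_id x a) (rep_delta x u)))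
     (rep_comp (s := Br a (Br u u)) (t := Br (Br u u) a) (u := Br u a)
        (rep_par (rep_delta x u) (rep_id x a)) (rep_c x a (Br u u)))
     (eqt_c_nat x (Id A) (deltaR x (Unit x))) X) as H.
  simpl in H. rewrite !eqt_par_id, !eqt_id_l, !eqt_id_r, gam_nat in H.
  rewrite H, par_comp_r. ra. reflexivity.
Qed.

Lemma gam_unit' {L} x (A X : form L) :
  (Id A ⟨x⟩ sigmaR x X) ∘ gam x (Unit x) A X ≡ sigmaR x (A ⟨x⟩ X).
Proof.
  rewrite <- gam_unit. ra. rewrite gam_inv. ids. reflexivity.
Qed.

Lemma sigma_c {L} x (A : form L) : sigmaR x A ∘ c x A (Unit x) ≡ deltaR x A.
Proof.
  pose (a := At A). pose (u := At (Unit x) : tree L).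
  refine (rep_eq (s := Br a u) (t := a)
    (rep_comp (t := Br u a) (rep_sigma x a) (rep_c x a u)) (rep_delta x a) _).
  intros X; simpl. apply gam_unit.
Qed.

Lemma c_unit {L} x : c (L := L) x (Unit x) (Unit x) ≡ Id _.
Proof.
  apply (cancel_l (eqt_sigmaLR x (Unit x))).
  rewrite sigma_c, eqt_delta_sigma. ids. reflexivity.
Qed.

(** For [x = And] this middle exchange is to conjunctions what [ck] is to disjunctions. *)
Definition mid {L} x (A1 A2 B1 B2 : form L) :
    term ((A1 ⟨x⟩ A2) ⟨x⟩ (B1 ⟨x⟩ B2)) ((A1 ⟨x⟩ B1) ⟨x⟩ (A2 ⟨x⟩ B2)) :=
  bR x A1 B1 (A2 ⟨x⟩ B2) ∘ ((Id A1 ⟨x⟩ gam x A2 B1 B2) ∘ bL x A1 A2 (B1 ⟨x⟩ B2)).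

Lemma mid_nat {L} x (A1 A2 B1 B2 A1' A2' B1' B2' : form L)
    (f1 : term A1 A1') (f2 : term A2 A2') (g1 : term B1 B1') (g2 : term B2 B2') :
  mid x A1' A2' B1' B2' ∘ ((f1 ⟨x⟩ f2) ⟨x⟩ (g1 ⟨x⟩ g2))
  ≡ ((f1 ⟨x⟩ g1) ⟨x⟩ (f2 ⟨x⟩ g2)) ∘ mid x A1 A2 B1 B2.
Proof.
  unfold mid. ra. rewrite bL_nat.
  rw (par_comp x (Id A1') f1 (gam x A2' B1' B2') (f2 ⟨x⟩ (g1 ⟨x⟩ g2))).
  rewrite gam_nat. ids. rewrite <- (eqt_id_r f1) at 1. rewrite eqt_par_comp. ra.
  rw (eqt_b_nat x f1 g1 (f2 ⟨x⟩ g2)). reflexivity.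
Qed.

Lemma rep_gam {L} x (s t u : tree L) :
  rep (s := Br s (Br t u)) (t := Br t (Br s u)) (gam x (fm x s) (fm x t) (fm x u))
    (fun X => sw x s t (act x u X)).
Proof.
  refine (rep_ext (s := Br s (Br t u)) (t := Br t (Br s u))
    (rep_comp (t := Br (Br t s) u) (rep_bL x t s u)
      (rep_comp (t := Br (Br s t) u)
        (rep_par (rep_c x s t) (rep_id x u)) (rep_bR x s t u))) _).
  intros X; cbn [act actm]. rewrite !actm_id. ids. reflexivity.
Qed.

Lemma rep_mid {L} x (s1 s2 t1 t2 : tree L) :
  rep (s := Br (Br s1 s2) (Br t1 t2)) (t := Br (Br s1 t1) (Br s2 t2))
    (mid x (fm x s1) (fm x s2) (fm x t1) (fm x t2))
    (fun X => actm x s1 (sw x s2 t1 (act x t2 X))).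
Proof.
  refine (rep_ext (s := Br (Br s1 s2) (Br t1 t2)) (t := Br (Br s1 t1) (Br s2 t2))
    (rep_comp (t := Br s1 (Br t1 (Br s2 t2))) (rep_bR x s1 t1 (Br s2 t2))
      (rep_comp (t := Br s1 (Br s2 (Br t1 t2)))
        (rep_par (rep_id x s1) (rep_gam x s2 t1 t2)) (rep_bL x s1 s2 (Br t1 t2)))) _).
  intros X; cbn [act actm]. ids. reflexivity.
Qed.

(** This lemma, [mid_c], [mid_delta] and [mid_sigma] are the counterparts for [mid] of the equations
    that relate [ck] to the associativity, symmetry and units of [∨]. On strict forms they reduce to
    properties of [gam]. *)
Lemma mid_b {L} x (A1 A2 B1 B2 C1 C2 : form L) :
  (bR x A1 B1 C1 ⟨x⟩ bR x A2 B2 C2)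
    ∘ (mid x A1 A2 (B1 ⟨x⟩ C1) (B2 ⟨x⟩ C2) ∘ (Id (A1 ⟨x⟩ A2) ⟨x⟩ mid x B1 B2 C1 C2))
  ≡ mid x (A1 ⟨x⟩ B1) (A2 ⟨x⟩ B2) C1 C2
    ∘ ((mid x A1 A2 B1 B2 ⟨x⟩ Id (C1 ⟨x⟩ C2)) ∘ bR x (A1 ⟨x⟩ A2) (B1 ⟨x⟩ B2) (C1 ⟨x⟩ C2)).
Proof.
  pose (a1 := At A1). pose (a2 := At A2). pose (b1 := At B1). pose (b2 := At B2).
  pose (c1 := At C1). pose (c2 := At C2).
  refine (rep_eq (s := Br (Br a1 a2) (Br (Br b1 b2) (Br c1 c2)))
    (t := Br (Br (Br a1 b1) c1) (Br (Br a2 b2) c2))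
    (rep_comp (t := Br (Br a1 (Br b1 c1)) (Br a2 (Br b2 c2)))
      (rep_par (rep_bR x a1 b1 c1) (rep_bR x a2 b2 c2))
      (rep_comp (t := Br (Br a1 a2) (Br (Br b1 c1) (Br b2 c2)))
        (rep_mid x a1 a2 (Br b1 c1) (Br b2 c2))
        (rep_par (rep_id x (Br a1 a2)) (rep_mid x b1 b2 c1 c2))))
    (rep_comp (t := Br (Br (Br a1 b1) (Br a2 b2)) (Br c1 c2))
      (rep_mid x (Br a1 b1) (Br a2 b2) c1 c2)
      (rep_comp (t := Br (Br (Br a1 a2) (Br b1 b2)) (Br c1 c2))
        (rep_par (rep_mid x a1 a2 b1 b2) (rep_id x (Br c1 c2)))
        (rep_bR x (Br a1 a2) (Br b1 b2) (Br c1 c2)))) _).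
  intros X; simpl. ids. rewrite !par_comp_r. ids. ra.
  rewrite <- !par_comp_r, gam_nat. reflexivity.
Qed.

Lemma mid_c {L} x (A1 A2 B1 B2 : form L) :
  mid x B1 B2 A1 A2 ∘ c x (A1 ⟨x⟩ A2) (B1 ⟨x⟩ B2)
  ≡ (c x A1 B1 ⟨x⟩ c x A2 B2) ∘ mid x A1 A2 B1 B2.
Proof.
  pose (a1 := At A1). pose (a2 := At A2). pose (b1 := At B1). pose (b2 := At B2).
  refine (rep_eq (s := Br (Br a1 a2) (Br b1 b2)) (t := Br (Br b1 a1) (Br b2 a2))
    (rep_comp (t := Br (Br b1 b2) (Br a1 a2))
      (rep_mid x b1 b2 a1 a2) (rep_c x (Br a1 a2) (Br b1 b2)))
    (rep_comp (t := Br (Br a1 b1) (Br a2 b2))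
      (rep_par (rep_c x a1 b1) (rep_c x a2 b2)) (rep_mid x a1 a2 b1 b2)) _).
  intros X; simpl. rewrite !par_comp_r. ra.
  rw (par_inv x (eqt_id_l (Id B1)) (gam_inv x A1 B2 (A2 ⟨x⟩ X)%form)). ids. reflexivity.
Qed.

Lemma mid_mid {L} x (A B C D : form L) : mid x A C B D ∘ mid x A B C D ≡ Id _.
Proof.
  unfold mid. ra. rw (eqt_bLR x A C (B ⟨x⟩ D)%form). ids.
  rw (par_inv x (eqt_id_l (Id A)) (gam_inv x B C D)). ids. apply eqt_bRL.
Qed.

Lemma mid_delta {L} x (A B : form L) :
  (deltaR x A ⟨x⟩ deltaR x B) ∘ mid x A B (Unit x) (Unit x)
  ≡ deltaR x (A ⟨x⟩ B) ∘ (Id (A ⟨x⟩ B) ⟨x⟩ deltaR x (Unit x)).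
Proof.
  pose (a := At A). pose (b := At B). pose (u := At (Unit x) : tree L).
  refine (rep_eq (s := Br (Br a b) (Br u u)) (t := Br a b)
    (rep_comp (t := Br (Br a u) (Br b u))
      (rep_par (rep_delta x a) (rep_delta x b)) (rep_mid x a b u u))
    (rep_comp (t := Br (Br a b) u)
      (rep_delta x (Br a b)) (rep_par (rep_id x (Br a b)) (rep_delta x u))) _).
  intros X; simpl. ids. rewrite !par_comp. ids.
  rewrite !eqt_sigma_nat. ra. rewrite gam_unit, <- par_comp_r. reflexivity.
Qed.

Lemma mid_sigma {L} x (A B : form L) :
  (sigmaR x A ⟨x⟩ sigmaR x B) ∘ mid x (Unit x) (Unit x) A B
  ≡ sigmaR x (A ⟨x⟩ B) ∘ (sigmaR x (Unit x) ⟨x⟩ Id (A ⟨x⟩ B)).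
Proof.
  pose (a := At A). pose (b := At B). pose (u := At (Unit x) : tree L).
  refine (rep_eq (s := Br (Br u u) (Br a b)) (t := Br a b)
    (rep_comp (t := Br (Br u a) (Br u b))
      (rep_par (rep_sigma x a) (rep_sigma x b)) (rep_mid x u u a b))
    (rep_comp (t := Br u (Br a b))
      (rep_sigma x (Br a b)) (rep_par (rep_sigma x u) (rep_id x (Br a b)))) _).
  intros X; simpl. ids. ra. rewrite par_comp, gam_unit'. ids.
  rewrite eqt_sigma_nat. reflexivity.
Qed.

Lemma mid_delta' {L} x (A B : form L) :
  deltaR x (A ⟨x⟩ B) ∘ ((Id (A ⟨x⟩ B) ⟨x⟩ deltaR x (Unit x)) ∘ mid x A (Unit x) B (Unit x))
  ≡ deltaR x A ⟨x⟩ deltaR x B.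
Proof.
  rw (eqt_sym (mid_delta x A B)). rewrite mid_mid. ids. reflexivity.
Qed.

Lemma mid_sigma' {L} x (A B : form L) :
  sigmaR x (A ⟨x⟩ B) ∘ ((sigmaR x (Unit x) ⟨x⟩ Id (A ⟨x⟩ B)) ∘ mid x (Unit x) A (Unit x) B)
  ≡ sigmaR x A ⟨x⟩ sigmaR x B.
Proof.
  rw (eqt_sym (mid_sigma x A B)). rewrite mid_mid. ids. reflexivity.
Qed.

Lemma mid_unit {L} x (A B : form L) : mid x A (Unit x) (Unit x) B ≡ Id _.
Proof.
  unfold mid, gam. rewrite c_unit. ids. rewrite eqt_bLR. ids. apply eqt_bRL.
Qed.

(** * Formulae with a constant or a letter as normal form *)

Definition mu {L} x (M N : form L) : term (M ⟨x⟩ N) (nu_bin x M N).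
Proof.
  (* If both arguments are the unit of [x], this order of trials selects [deltaR]; [eqt_delta_sigma]
     exchanges it for [sigmaR] where the latter is expected. *)
  destruct x, M as [p | [|] | y M1 M2], N as [q | [|] | z N1 N2]; cbn;
    first [exact (Id _) | exact (deltaR _ _) | exact (sigmaR _ _)
          | exact wbotR | exact wtopR].
Defined.

Definition muI {L} x (M N : form L) : term (nu_bin x M N) (M ⟨x⟩ N).
Proof.
  destruct x, M as [p | [|] | y M1 M2], N as [q | [|] | z N1 N2]; cbn;
    first [exact (Id _) | exact (deltaL _ _) | exact (sigmaL _ _)
          | exact wbotL | exact wtopL].
Defined.

Lemma muI_mu {L} x (M N : form L) : muI x M N ∘ mu x M N ≡ Id _.
Proof.
  destruct x, M as [p | [|] | y M1 M2], N as [q | [|] | z N1 N2]; cbn;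
    first [apply eqt_id_l | apply eqt_deltaLR | apply eqt_sigmaLR
          | apply eqt_wbotLR | apply eqt_wtopLR].
Qed.

Fixpoint phi {L} (A : form L) : term A (nu A) :=
  match A with
  | Letter p => Id _
  | Unit z => Id _
  | Bin x A B => mu x (nu A) (nu B) ∘ (phi A ⟨x⟩ phi B)
  end.

Fixpoint phiI {L} (A : form L) : term (nu A) A :=
  match A with
  | Letter p => Id _
  | Unit z => Id _
  | Bin x A B => (phiI A ⟨x⟩ phiI B) ∘ muI x (nu A) (nu B)
  end.

Lemma phiI_phi {L} (A : form L) : phiI A ∘ phi A ≡ Id _.
Proof.
  induction A as [p | z | x A IHA B IHB]; cbn; ids; try reflexivity.
  ra. rw (muI_mu x (nu A) (nu B)). ids. apply par_inv; assumption.
Qed.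

Definition atom {L} (A : form L) : Prop :=
  match A with Bin _ _ _ => False | _ => True end.

(** Between formulae with atomic normal forms, these are the arrows that remain after transport
    along [phi]. *)
Inductive basic {L} : forall A B : form L, term A B -> Prop :=
| basic_id A : basic (Id A)
| basic_kappa : basic kappa.

Lemma basic_unique {L} (A B : form L) (k k' : term A B) : basic k -> basic k' -> k = k'.
Proof.
  intros H H'. dependent destruction H; dependent destruction H'; reflexivity.
Qed.

Lemma atom_nu_bin {L} x (M N : form L) : atom (nu_bin x M N) -> atom M /\ atom N.
Proof.
  destruct x, M as [p | [|] | y M1 M2], N as [q | [|] | z N1 N2]; cbn; tauto.
Qed.

Lemma sigma_kappa_wbot {L} : sigmaR And (L := L) ⊥ ∘ (kappa ∧ Id ⊥) ≡ wbotR.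
Proof.
  apply (cancel_r (eqt_wbotLR (L := L))). ra. rewrite <- eqt_kappa_wbot_sigma.
  rewrite eqt_wbotRL. apply eqt_sigmaRL.
Qed.

Lemma delta_kappa_wbot {L} : deltaR And (L := L) ⊥ ∘ (Id ⊥ ∧ kappa) ≡ wbotR.
Proof.
  apply (cancel_r (eqt_wbotLR (L := L))). ra. rewrite <- eqt_kappa_wbot_delta.
  rewrite eqt_wbotRL. apply eqt_deltaRL.
Qed.

(** A single [kappa] either survives, with [h = kappa], or trades a unit arrow against [wbotR] or
    [wtopR], with [h] an identity. The second possibility is what the equations for [kappa] with
    [wbotL] and [wtopR] express. *)
Lemma mu_nat {L} x (M N M' N' : form L) (k : term M M') (l : term N N') :
  basic k -> basic l -> atom (nu_bin x M N) -> atom (nu_bin x M' N') ->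
  exists h, basic h /\ (mu x M' N' ∘ (k ⟨x⟩ l) ≡ h ∘ mu x M N).
Proof.
  intros Hk Hl. destruct Hk as [M |], Hl as [N |].
  - intros _ _. exists (Id _). split; [constructor | ids; reflexivity].
  - destruct x, M as [p | [|] | y M1 M2]; cbn; intros HM HN; try tauto.
    + exists kappa; split; [constructor | rewrite eqt_delta_sigma; apply eqt_sigma_nat].
    + exists (Id _); split; [constructor | ids; apply delta_kappa_wbot].
    + exists (Id _); split; [constructor | ids; symmetry; apply eqt_kappa_wtop_delta].
    + exists kappa; split; [constructor | rewrite eqt_delta_sigma; apply eqt_sigma_nat].
  - destruct x, N as [p | [|] | y M1 M2]; cbn; intros HM HN; try tauto.
    + exists kappa; split; [constructor | apply eqt_delta_nat].
    + exists (Id _); split; [constructor | ids; apply sigma_kappa_wbot].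
    + exists (Id _); split; [constructor | ids; symmetry; apply eqt_kappa_wtop_sigma].
    + exists kappa; split; [constructor | apply eqt_delta_nat].
  - intros _ _. exists kappa. split; [constructor |]. destruct x; cbn.
    + rewrite (par_lr And kappa kappa). rw (eqt_delta_nat And (kappa (L := L))).
      rewrite delta_kappa_wbot. reflexivity.
    + rewrite (par_rl Or kappa kappa). rw (eqt_sym (eqt_kappa_wtop_delta (L := L))).
      apply eqt_delta_nat.
Qed.

Lemma delta_b {L} x (A B : form L) :
  deltaR x (A ⟨x⟩ B) ∘ bR x A B (Unit x) ≡ Id A ⟨x⟩ deltaR x B.
Proof. rewrite <- b_unit_r. ra. rewrite eqt_bLR. ids. reflexivity. Qed.

Lemma delta_c {L} x (A : form L) : deltaR x A ∘ c x (Unit x) A ≡ sigmaR x A.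
Proof. rewrite <- sigma_c. ra. rewrite eqt_cc. ids. reflexivity. Qed.

Lemma mu_b_unit1 {L} x (A B N : form L) (m : term (A ⟨x⟩ B) N) :
  m ∘ ((sigmaR x A ⟨x⟩ Id B) ∘ bR x (Unit x) A B) ≡ sigmaR x N ∘ (Id _ ⟨x⟩ m).
Proof. rewrite b_unit_l, eqt_sigma_nat. reflexivity. Qed.

Lemma mu_b_unit2 {L} x (A B N : form L) (m : term (A ⟨x⟩ B) N) :
  m ∘ ((deltaR x A ⟨x⟩ Id B) ∘ bR x A (Unit x) B) ≡ m ∘ (Id _ ⟨x⟩ sigmaR x B).
Proof. rewrite eqt_b_unit, par_comp, eqt_deltaRL. ids. reflexivity. Qed.

Lemma mu_b_unit3 {L} x (A B N : form L) (m : term (A ⟨x⟩ B) N) :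
  deltaR x N ∘ ((m ⟨x⟩ Id _) ∘ bR x A B (Unit x)) ≡ m ∘ (Id _ ⟨x⟩ deltaR x B).
Proof. rw (eqt_delta_nat x m). rewrite delta_b. reflexivity. Qed.

Lemma wbotR_b {L} :
  wbotR ∘ ((wbotR ∧ Id ⊥) ∘ bR And (L := L) ⊥ ⊥ ⊥) ≡ wbotR ∘ (Id ⊥ ∧ wbotR).
Proof.
  symmetry.
  apply (cancel_l (i := (Id ⊥ ∧ wbotL) ∘ wbotL) (j := wbotR ∘ (Id ⊥ ∧ wbotR))).
  { ra. rw (par_inv And (eqt_id_l (Id ⊥)) (eqt_wbotRL (L := L))). ids. apply eqt_wbotRL. }
  rewrite <- eqt_wbot_b at 2. ra. rw (eqt_wbotLR (L := L)). ids.
  rw (eqt_wbotLR (L := L)). ids.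
  rw (par_inv And (eqt_wbotLR (L := L)) (eqt_id_l (Id ⊥))). ids. rewrite eqt_bLR.
  apply par_inv; [apply eqt_id_l | apply eqt_wbotLR].
Qed.

Lemma wtopR_b {L} :
  wtopR ∘ ((wtopR ∨ Id ⊤) ∘ bR Or (L := L) ⊤ ⊤ ⊤) ≡ wtopR ∘ (Id ⊤ ∨ wtopR).
Proof. rewrite eqt_assoc. apply eqt_wtop_b. Qed.

Lemma wbotR_c {L} : wbotR ∘ c And (L := L) ⊥ ⊥ ≡ wbotR.
Proof.
  apply (cancel_r (eqt_wbotLR (L := L))). ra. rewrite eqt_wbot_c. reflexivity.
Qed.

Ltac unit_exists :=
  exists (Id _), (Id _); split; [constructor | split; [constructor | split; [apply eqt_id_l |]]]; ids.

(** The arrow [l] undoes [k], so that the one equation serves [bR] through [k] and [bL] through [l].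
    The same device is used in [mu_delta] and [mu_sigma]. *)
Lemma mu_b {L} x (A B C : form L) :
  atom (nu_bin x (nu_bin x A B) C) -> atom (nu_bin x A (nu_bin x B C)) ->
  exists k l, basic k /\ basic l /\ (l ∘ k ≡ Id _) /\
    (mu x (nu_bin x A B) C ∘ ((mu x A B ⟨x⟩ Id C) ∘ bR x A B C)
     ≡ k ∘ (mu x A (nu_bin x B C) ∘ (Id A ⟨x⟩ mu x B C))).
Proof.
  intros H1 H2. destruct (atom_nu_bin H1) as [H3 HC], (atom_nu_bin H3) as [HA HB].
  destruct A as [p | u | y A1 A2]; try contradiction;
  destruct B as [q | v | y B1 B2]; try contradiction;
  destruct C as [r | w | y C1 C2]; try contradiction;
  try destruct u; try destruct v; try destruct w; destruct x; cbn in *; try contradiction;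
  unit_exists;
  first [ rewrite ?eqt_delta_sigma; apply mu_b_unit1
        | apply mu_b_unit2
        | rewrite <- ?eqt_delta_sigma; apply mu_b_unit3
        | apply wbotR_b | apply wtopR_b ].
Qed.

Lemma mu_c {L} x (A B : form L) :
  atom (nu_bin x A B) ->
  exists k, basic k /\ (mu x B A ∘ c x A B ≡ k ∘ mu x A B).
Proof.
  intros H1. destruct (atom_nu_bin H1) as [HA HB].
  destruct A as [p | u | y A1 A2]; try contradiction;
  destruct B as [q | v | y B1 B2]; try contradiction;
  try destruct u; try destruct v; destruct x; cbn in *; try contradiction;
  exists (Id _); (split; [constructor |]); ids;
  first [ apply delta_c | apply sigma_c | apply wbotR_c | apply eqt_wtop_c
        | rewrite c_unit; apply eqt_id_r ].
Qed.

Lemma mu_delta {L} x (A : form L) : atom A ->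
  exists k l, basic k /\ basic l /\ (l ∘ k ≡ Id _) /\ (deltaR x A ≡ k ∘ mu x A (Unit x)).
Proof.
  intros HA. destruct A as [p | u | y A1 A2]; try contradiction;
  destruct x; try destruct u; cbn; unit_exists; reflexivity.
Qed.

Lemma mu_sigma {L} x (A : form L) : atom A ->
  exists k l, basic k /\ basic l /\ (l ∘ k ≡ Id _) /\ (sigmaR x A ≡ k ∘ mu x (Unit x) A).
Proof.
  intros HA. destruct A as [p | u | y A1 A2]; try contradiction;
  destruct x; try destruct u; cbn; unit_exists; rewrite <- ?eqt_delta_sigma; reflexivity.
Qed.

(** This and the next three lemmas put the unit equations of [ck] into the shape in which [mu_ck]
    meets them: [wbotL], [deltaL] or [sigmaL] is moved to the other side as its inverse, and a
    further arrow [m] is absorbed by naturality. *)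
Lemma ck_delta_or {L} (A B N : form L) (m : term (A ∧ B)%form N) :
  m ∘ ((deltaR Or A ∧ deltaR Or B) ∘ ck A B ⊥ ⊥) ≡ deltaR Or N ∘ (m ∨ wbotR).
Proof.
  rewrite (par_lr Or m wbotR). rw (eqt_delta_nat Or m). rewrite eqt_ck_deltaOr. ra.
  rewrite (par_inv Or (eqt_id_l (Id _)) (eqt_wbotLR (L := L))). ids. reflexivity.
Qed.

Lemma ck_sigma_or {L} (A B N : form L) (m : term (A ∧ B)%form N) :
  m ∘ ((sigmaR Or A ∧ sigmaR Or B) ∘ ck ⊥ ⊥ A B) ≡ sigmaR Or N ∘ (wbotR ∨ m).
Proof.
  rewrite (par_rl Or wbotR m). rw (eqt_sigma_nat Or m). rewrite eqt_ck_sigmaOr. ra.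
  rewrite (par_inv Or (eqt_wbotLR (L := L)) (eqt_id_l (Id _))). ids. reflexivity.
Qed.

Lemma ck_delta_and {L} (A B N : form L) (m : term (A ∨ B)%form N) :
  deltaR And N ∘ ((m ∧ wtopR) ∘ ck A ⊤ B ⊤) ≡ m ∘ (deltaR And A ∨ deltaR And B).
Proof.
  rewrite (par_lr And m wtopR). ra. rw (eqt_delta_nat And m).
  apply (cancel_r (i := deltaL And A ∨ deltaL And B) (j := deltaR And A ∨ deltaR And B)).
  { apply par_inv; apply eqt_deltaLR. }
  ra. pose proof (eqt_ck_deltaAnd A B) as H. rewrite <- eqt_assoc in H.
  rewrite <- H. rewrite eqt_deltaRL.
  rewrite (par_inv Or (eqt_deltaRL And A) (eqt_deltaRL And B)). reflexivity.
Qed.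

Lemma ck_sigma_and {L} (A B N : form L) (m : term (A ∨ B)%form N) :
  sigmaR And N ∘ ((wtopR ∧ m) ∘ ck ⊤ A ⊤ B) ≡ m ∘ (sigmaR And A ∨ sigmaR And B).
Proof.
  rewrite (par_rl And wtopR m). ra. rw (eqt_sigma_nat And m).
  apply (cancel_r (i := sigmaL And A ∨ sigmaL And B) (j := sigmaR And A ∨ sigmaR And B)).
  { apply par_inv; apply eqt_sigmaLR. }
  ra. pose proof (eqt_ck_sigmaAnd A B) as H. rewrite <- eqt_assoc in H.
  rewrite <- H. rewrite eqt_sigmaRL.
  rewrite (par_inv Or (eqt_sigmaRL And A) (eqt_sigmaRL And B)). reflexivity.
Qed.

Lemma mu_ck {L} (A B C D : form L) :
  atom (nu_bin Or (nu_bin And A B) (nu_bin And C D)) ->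
  atom (nu_bin And (nu_bin Or A C) (nu_bin Or B D)) ->
  exists k, basic k /\
    (mu And (nu_bin Or A C) (nu_bin Or B D) ∘ ((mu Or A C ∧ mu Or B D) ∘ ck A B C D)
     ≡ k ∘ (mu Or (nu_bin And A B) (nu_bin And C D) ∘ (mu And A B ∨ mu And C D))).
Proof.
  intros H1 H2. destruct (atom_nu_bin H1) as [H3 H4].
  destruct (atom_nu_bin H3) as [HA HB], (atom_nu_bin H4) as [HC HD].
  destruct A as [p | u | y A1 A2]; try contradiction;
  destruct B as [q | v | y B1 B2]; try contradiction;
  destruct C as [r | w | y C1 C2]; try contradiction;
  destruct D as [s | z | y D1 D2]; try contradiction;
  try destruct u; try destruct v; try destruct w; try destruct z;
  cbn in *; try contradiction;
  (* By typing, [kappa] is the witness exactly for the indices [⊤, ⊥, ⊥, ⊤] and [⊥, ⊤, ⊤, ⊥]. These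
     are the cases of [eqt_ck_kappa1] and [eqt_ck_kappa2]. *)
  first [ exists (Id _) | exists kappa ]; (split; [constructor |]); ids;
  first [ rewrite <- ?eqt_delta_sigma; apply ck_delta_or
        | rewrite ?eqt_delta_sigma; apply ck_sigma_or
        | rewrite <- ?eqt_delta_sigma; apply ck_delta_and
        | rewrite ?eqt_delta_sigma; apply ck_sigma_and
        | rewrite !eqt_assoc; apply eqt_ck_kappa1
        | rewrite !eqt_assoc; apply eqt_ck_kappa2 ].
Qed.

(** * Invariants of arrows: letters and truth values *)

Lemma letters_perm {L} (A B : form L) (f : term A B) : Permutation (letters A) (letters B).
Proof.
  induction f; cbn; rewrite ?app_nil_r, ?app_assoc; auto using Permutation_app, Permutation_app_comm.
  - eapply Permutation_trans; eassumption.
  - apply Permutation_app_tail. rewrite <- !app_assoc. apply Permutation_app_head.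
    apply Permutation_app_comm.
Qed.

Fixpoint ev {L} (v : L -> Prop) (A : form L) : Prop :=
  match A with
  | Letter p => v p
  | Unit And => True
  | Unit Or => False
  | Bin And A B => ev v A /\ ev v B
  | Bin Or A B => ev v A \/ ev v B
  end.

Lemma ev_mono {L} (v : L -> Prop) (A B : form L) (f : term A B) : ev v A -> ev v B.
Proof. induction f; try destruct x; cbn; tauto. Qed.

Lemma ev_nu {L} (v : L -> Prop) (A : form L) : ev v (nu A) <-> ev v A.
Proof. split; apply ev_mono; [apply phiI | apply phi]. Qed.

Lemma letters_nu_bin {L} x (M N : form L) : letters (nu_bin x M N) = letters M ++ letters N.
Proof.
  destruct x, M as [p | [|] | y M1 M2], N as [q | [|] | z N1 N2]; cbn;
    rewrite ?app_nil_r; reflexivity.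
Qed.

Lemma letters_nu {L} (A : form L) : letters (nu A) = letters A.
Proof.
  induction A as [p | z | x A IHA B IHB]; cbn; try reflexivity.
  rewrite letters_nu_bin, IHA, IHB; reflexivity.
Qed.

Lemma nu_letterless {L} (A : form L) : letters A = nil -> exists z, nu A = Unit z.
Proof.
  induction A as [p | z | x A IHA B IHB]; cbn; intros H.
  - discriminate.
  - exists z; reflexivity.
  - apply app_eq_nil in H as [HA HB].
    destruct (IHA HA) as [a ->], (IHB HB) as [b ->].
    destruct x, a, b; cbn; eauto.
Qed.

(** One of the two sides is letterless and normalizes to a constant. If that were not the unit of
    the connective, the truth value would not depend on [p]; the constant valuations [ET] and [EF]
    exclude this. *)
Lemma nu_one_letter {L} (p : L) (A : form L) :
  letters A = p :: nil -> (forall v, ev v A <-> v p) -> nu A = Letter p.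
Proof.
  induction A as [q | z | x A IHA B IHB]; cbn; intros H E.
  - congruence.
  - discriminate.
  - assert (ET := E (fun _ => True)). assert (EF := E (fun _ => False)).
    apply app_eq_unit in H as [[HA HB] | [HA HB]].
    + destruct (nu_letterless HA) as [z Hz].
      assert (Ez : forall v, ev v A <-> ev v (Unit z)) by (intros v; rewrite <- Hz; symmetry; apply ev_nu).
      rewrite Hz, IHB.
      * destruct x, z; cbn in *; try reflexivity; exfalso;
          rewrite !Ez in ET, EF; tauto.
      * assumption.
      * intros v. specialize (E v).
        destruct x, z; cbn in *; rewrite !Ez in *; tauto.
    + destruct (nu_letterless HB) as [z Hz].
      assert (Ez : forall v, ev v B <-> ev v (Unit z)) by (intros v; rewrite <- Hz; symmetry; apply ev_nu).
      rewrite Hz, IHA.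
      * destruct x, z; cbn in *; try reflexivity; exfalso;
          rewrite !Ez in ET, EF; tauto.
      * assumption.
      * intros v. specialize (E v).
        destruct x, z; cbn in *; rewrite !Ez in *; tauto.
Qed.

(* Truth values exclude, between [p] and [p], objects such as [p ∨ ⊤]. *)
Lemma atom_middle {L} (A B C : form L) (f : term A C) (g : term C B) :
  atom (nu A) -> atom (nu B) -> atom (nu C).
Proof.
  intros HA HB.
  pose proof (letters_perm f) as Pf. pose proof (letters_perm g) as Pg.
  rewrite <- (letters_nu A) in Pf. rewrite <- (letters_nu B) in Pg.
  assert (EA := fun v => ev_nu v A). assert (EB := fun v => ev_nu v B).
  destruct (nu A) as [p | z | y A1 A2]; try contradiction; cbn in Pf.
  - apply Permutation_length_1_inv in Pf. rewrite Pf in Pg.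
    apply Permutation_length_1_inv in Pg.
    destruct (nu B) as [q | w | y B1 B2]; try contradiction; cbn in Pg; try discriminate.
    injection Pg as ->.
    rewrite (nu_one_letter Pf); [exact I |].
    intros v. cbn in EA, EB. split; intros H.
    + apply EB, (ev_mono g H).
    + apply (ev_mono f), EA, H.
  - apply Permutation_nil in Pf. destruct (nu_letterless Pf) as [w ->]. exact I.
Qed.

Lemma basic_comp {L} (A B C : form L) (l : term B C) (k : term A B) :
  basic l -> basic k -> exists h, basic h /\ (h ≡ l ∘ k).
Proof.
  intros Hl Hk. destruct Hk.
  - exists l; split; [assumption | ids; reflexivity].
  - dependent destruction Hl. exists kappa. split; [constructor | ids; reflexivity].
Qed.

(** Induction on [f] works because atomicity of the normal forms passes to the parts: by
    [atom_middle] for a composition, by [atom_nu_bin] for [Par]. The remaining cases are the lemmas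
    on [mu]. *)
Lemma phi_nat {L} (A B : form L) (f : term A B) :
  atom (nu A) -> atom (nu B) ->
  exists k, basic k /\ (phi B ∘ f ≡ k ∘ phi A).
Proof.
  induction f as [A | A B C g IHg f IHf | x A B A' B' f IHf g IHg | x A B C | x A B C
    | x A B | x A | x A | x A | x A | | | | | | A B C D]; intros HA HB.
  - exists (Id _). split; [constructor | ids; reflexivity].
  - assert (HC := atom_middle f g HA HB).
    destruct (IHf HA HC) as (k & Hk & Ek), (IHg HC HB) as (l & Hl & El).
    destruct (basic_comp Hl Hk) as (h & Hh & Eh). exists h; split; [assumption |].
    rewrite Eh. rw El. rewrite Ek. reflexivity.
  - cbn in *. destruct (atom_nu_bin HA) as [HA1 HA2], (atom_nu_bin HB) as [HB1 HB2].
    destruct (IHf HA1 HB1) as (k & Hk & Ek), (IHg HA2 HB2) as (l & Hl & El).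
    destruct (mu_nat Hk Hl HA HB) as (h & Hh & Eh). exists h; split; [assumption |].
    ra. rewrite par_comp, Ek, El, eqt_par_comp. rw Eh. reflexivity.
  - cbn in *. destruct (mu_b HB HA) as (k & l & Hk & Hl & _ & E).
    exists k; split; [assumption |].
    transitivity (mu x (nu_bin x (nu A) (nu B)) (nu C)
      ∘ ((mu x (nu A) (nu B) ⟨x⟩ Id _)
      ∘ (((phi A ⟨x⟩ phi B) ⟨x⟩ phi C) ∘ bR x A B C))).
    { rw (par_comp x (mu x (nu A) (nu B)) (phi A ⟨x⟩ phi B) (Id _) (phi C)). ids. reflexivity. }
    rewrite <- eqt_b_nat. rw E. rw (par_comp x (Id (nu A)) (phi A) (mu x (nu B) (nu C)) (phi B ⟨x⟩ phi C)). ids. reflexivity.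
  - cbn in *. destruct (mu_b HA HB) as (k & l & Hk & Hl & Hlk & E).
    exists l; split; [assumption |].
    apply (cancel_r (i := bR x A B C) (eqt_bRL x A B C)).
    ra. rewrite eqt_bLR. ids.
    transitivity (l ∘ (mu x (nu_bin x (nu A) (nu B)) (nu C)
      ∘ ((mu x (nu A) (nu B) ⟨x⟩ Id _)
      ∘ (((phi A ⟨x⟩ phi B) ⟨x⟩ phi C) ∘ bR x A B C)))).
    + rewrite <- eqt_b_nat. rw E. rw Hlk. ids. rw (par_comp x (Id (nu A)) (phi A) (mu x (nu B) (nu C)) (phi B ⟨x⟩ phi C)). ids. reflexivity.
    + rw (par_comp x (mu x (nu A) (nu B)) (phi A ⟨x⟩ phi B) (Id _) (phi C)). ids. reflexivity.
  - cbn in *. destruct (mu_c HA) as (k & Hk & E). exists k; split; [assumption |].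
    ra. rewrite <- eqt_c_nat. rw E. reflexivity.
  - cbn in *. destruct (mu_delta x HB) as (k & l & Hk & Hl & _ & E).
    exists k; split; [assumption |].
    rewrite <- eqt_delta_nat, E. ra. reflexivity.
  - cbn in *. destruct (mu_delta x HA) as (k & l & Hk & Hl & Hlk & E).
    exists l; split; [assumption |].
    apply (cancel_r (i := deltaR x A) (eqt_deltaRL x A)).
    ra. rewrite eqt_deltaLR, <- eqt_delta_nat, E. ra. rw Hlk. ids. reflexivity.
  - cbn in *. destruct (mu_sigma x HB) as (k & l & Hk & Hl & _ & E).
    exists k; split; [assumption |].
    rewrite <- eqt_sigma_nat, E. ra. reflexivity.
  - cbn in *. destruct (mu_sigma x HA) as (k & l & Hk & Hl & Hlk & E).
    exists l; split; [assumption |].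
    apply (cancel_r (i := sigmaR x A) (eqt_sigmaRL x A)).
    ra. rewrite eqt_sigmaLR, <- eqt_sigma_nat, E. ra. rw Hlk. ids. reflexivity.
  - exists (Id _). split; [constructor |]. cbn. ids. apply eqt_wbotRL.
  - exists (Id _). split; [constructor |]. cbn. ids. reflexivity.
  - exists (Id _). split; [constructor |]. cbn. ids. reflexivity.
  - exists (Id _). split; [constructor |]. cbn. ids. apply eqt_wtopRL.
  - exists kappa. split; [constructor |]. cbn. ids. reflexivity.
  - cbn in *. destruct (mu_ck HA HB) as (k & Hk & E). exists k; split; [assumption |].
    rewrite !eqt_par_comp. ra. rewrite <- eqt_ck_nat. rw E. reflexivity.
Qed.

(** Both arrows reduce to basic ones, and the type alone decides between an identity and [kappa]. *)
Lemma atom_coherence {L} (A B : form L) (f g : term A B) :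
  atom (nu A) -> atom (nu B) -> f ≡ g.
Proof.
  intros HA HB. destruct (phi_nat f HA HB) as (k & Hk & Ek), (phi_nat g HA HB) as (l & Hl & El).
  rewrite (basic_unique Hl Hk) in El.
  apply (cancel_l (phiI_phi B)). rewrite Ek, El. reflexivity.
Qed.

(** * The duplication transformation *)

Lemma ck_nat_id {L} (A B C D B' D' : form L) (f : term B B') (g : term D D') :
  (Id (A ∨ C) ∧ (f ∨ g)) ∘ ck A B C D ≡ ck A B' C D' ∘ ((Id A ∧ f) ∨ (Id C ∧ g)).
Proof. rewrite eqt_ck_nat, eqt_par_id. reflexivity. Qed.

Lemma ck_nat_id' {L} (A B C D A' C' : form L) (f : term A A') (g : term C C') :
  ((f ∨ g) ∧ Id (B ∨ D)) ∘ ck A B C D ≡ ck A' B C' D ∘ ((f ∧ Id B) ∨ (g ∧ Id D)).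
Proof. rewrite eqt_ck_nat, eqt_par_id. reflexivity. Qed.

Lemma ck_bL {L} (A1 A2 A3 A1' A2' A3' : form L) :
  bL And (A1 ∨ A1') (A2 ∨ A2') (A3 ∨ A3')
    ∘ ((ck A1 A2 A1' A2' ∧ Id (A3 ∨ A3')) ∘ ck (A1 ∧ A2) A3 (A1' ∧ A2') A3')
  ≡ (Id (A1 ∨ A1') ∧ ck A2 A3 A2' A3') ∘ (ck A1 (A2 ∧ A3) A1' (A2' ∧ A3')
    ∘ (bL And A1 A2 A3 ∨ bL And A1' A2' A3')).
Proof. rewrite !eqt_assoc. apply eqt_ck_bAnd. Qed.

Lemma ck_bR {L} (A1 A2 A3 A1' A2' A3' : form L) :
  bR And (A1 ∨ A1') (A2 ∨ A2') (A3 ∨ A3')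
    ∘ ((Id (A1 ∨ A1') ∧ ck A2 A3 A2' A3') ∘ ck A1 (A2 ∧ A3) A1' (A2' ∧ A3'))
  ≡ (ck A1 A2 A1' A2' ∧ Id (A3 ∨ A3')) ∘ (ck (A1 ∧ A2) A3 (A1' ∧ A2') A3'
    ∘ (bR And A1 A2 A3 ∨ bR And A1' A2' A3')).
Proof.
  apply (cancel_l (eqt_bRL And (A1 ∨ A1')%form (A2 ∨ A2')%form (A3 ∨ A3')%form)).
  rw (eqt_bLR And (A1 ∨ A1')%form (A2 ∨ A2')%form (A3 ∨ A3')%form).
  rw (ck_bL A1 A2 A3 A1' A2' A3').
  rewrite (par_inv Or (eqt_bLR And A1 A2 A3) (eqt_bLR And A1' A2' A3')). ids. reflexivity.
Qed.

Lemma ck_gam {L} (A B C A' B' C' : form L) :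
  gam And (A ∨ A') (B ∨ B') (C ∨ C')
    ∘ ((Id (A ∨ A') ∧ ck B C B' C') ∘ ck A (B ∧ C) A' (B' ∧ C'))
  ≡ (Id (B ∨ B') ∧ ck A C A' C') ∘ (ck B (A ∧ C) B' (A' ∧ C')
    ∘ (gam And A B C ∨ gam And A' B' C')).
Proof.
  unfold gam. ra. rewrite ck_bR.
  rw (par_comp And (c And (A ∨ A')%form (B ∨ B')%form) (ck A B A' B') (Id _) (Id (C ∨ C')%form)).
  rewrite eqt_ck_cAnd. ids. rewrite par_comp_l. ra.
  rw (ck_nat_id' C C' (c And A B) (c And A' B')).
  rw (ck_bL B A C B' A' C'). rewrite !par_comp. reflexivity.
Qed.

(** This is what naturality of [dup] at [ck] amounts to. The associativities and the symmetry inside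
    [mid] pass through [ck] one after another, by [ck_bL], [ck_gam] and [ck_bR]. *)
Lemma ck_mid {L} (A B C D A' B' C' D' : form L) :
  mid And (A ∨ A') (B ∨ B') (C ∨ C') (D ∨ D')
    ∘ ((ck A B A' B' ∧ ck C D C' D') ∘ ck (A ∧ B) (C ∧ D) (A' ∧ B') (C' ∧ D'))
  ≡ (ck A C A' C' ∧ ck B D B' D') ∘ (ck (A ∧ C) (B ∧ D) (A' ∧ C') (B' ∧ D')
    ∘ (mid And A B C D ∨ mid And A' B' C' D')).
Proof.
  unfold mid. ra. rewrite (par_rl And (ck A B A' B') (ck C D C' D')). ra.
  rewrite <- (eqt_par_id And (A ∨ A') (B ∨ B')).
  rw (bL_nat And (Id (A ∨ A')%form) (Id (B ∨ B')%form) (ck C D C' D')).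
  rewrite ck_bL.
  rw (par_comp And (Id (A ∨ A')%form) (Id _) (Id (B ∨ B')%form ∧ ck C D C' D') (ck B (C ∧ D)%form B' (C' ∧ D')%form)).
  rw (par_comp And (Id (A ∨ A')%form) (Id _ ∘ Id _) (gam And (B ∨ B')%form (C ∨ C')%form (D ∨ D')%form)
     ((Id (B ∨ B')%form ∧ ck C D C' D') ∘ (ck B (C ∧ D)%form B' (C' ∧ D')%form))).
  rewrite ck_gam. ids. rewrite !par_comp_r. ra.
  rw (ck_nat_id A A' (gam And B C D) (gam And B' C' D')).
  rw (eqt_b_nat And (Id (A ∨ A')%form) (Id (C ∨ C')%form) (ck B D B' D')). ids.
  rw (ck_bR A C (B ∧ D)%form A' C' (B' ∧ D')%form).
  rw (eqt_sym (par_rl And (ck A C A' C') (ck B D B' D'))).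
  rewrite !par_comp. reflexivity.
Qed.

Fixpoint subst {L} (s : L -> form L) (A : form L) : form L :=
  match A with
  | Letter p => s p
  | Unit z => Unit z
  | Bin x A B => subst s A ⟨x⟩ subst s B
  end.

Fixpoint tsubst {L} (s : L -> form L) (A B : form L) (f : term A B) :
    term (subst s A) (subst s B) :=
  match f in term A B return term (subst s A) (subst s B) with
  | Id A => Id (subst s A)
  | Comp g f => tsubst s g ∘ tsubst s f
  | Par x f g => Par x (tsubst s f) (tsubst s g)
  | bR x A B C => bR x (subst s A) (subst s B) (subst s C)
  | bL x A B C => bL x (subst s A) (subst s B) (subst s C)
  | c x A B => c x (subst s A) (subst s B)
  | deltaR x A => deltaR x (subst s A)
  | deltaL x A => deltaL x (subst s A)
  | sigmaR x A => sigmaR x (subst s A)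
  | sigmaL x A => sigmaL x (subst s A)
  | wbotL => wbotL
  | wbotR => wbotR
  | wtopR => wtopR
  | wtopL => wtopL
  | kappa => kappa
  | ck A B C D => ck (subst s A) (subst s B) (subst s C) (subst s D)
  end.

(** Constants are doubled by isomorphisms, so the only freedom lies in the letters; it is recorded
    in [d]. *)
Fixpoint dup {L} (s t : L -> form L) (d : forall p, term (Letter p) (s p ∧ t p))
    (A : form L) : term A (subst s A ∧ subst t A) :=
  match A with
  | Letter p => d p
  | Unit And => deltaL And ⊤
  | Unit Or => wbotL
  | Bin And A B => mid And _ _ _ _ ∘ (dup d A ∧ dup d B)
  | Bin Or A B => ck _ _ _ _ ∘ (dup d A ∨ dup d B)
  end.

(** For each transformation of the definition, an equation of [mid] settles the [∧] version and an
    equation of [ck] the [∨] version. Arrows between constants fall under [atom_coherence]. No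
    generator acts on an individual letter, hence [d] is arbitrary. *)
Lemma dup_nat {L} (s t : L -> form L) (d : forall p, term (Letter p) (s p ∧ t p))
    (A B : form L) (f : term A B) :
  dup d B ∘ f ≡ (tsubst s f ∧ tsubst t f) ∘ dup d A.
Proof.
  (* Naturality at an isomorphism gives it at the inverse; this serves [bL], [deltaL] and
     [sigmaL]. *)
  assert (inv : forall A B (i : term A B) (j : term B A), i ∘ j ≡ Id _ ->
    tsubst s j ∘ tsubst s i ≡ Id _ -> tsubst t j ∘ tsubst t i ≡ Id _ ->
    dup d B ∘ i ≡ (tsubst s i ∧ tsubst t i) ∘ dup d A ->
    dup d A ∘ j ≡ (tsubst s j ∧ tsubst t j) ∘ dup d B).
  { intros A0 B0 i j H1 H2 H3 E.
    apply (square_inv H1 (par_inv And H2 H3) (eqt_sym E)). }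
  assert (Hb : forall x A B C, dup d _ ∘ bR x A B C
     ≡ (tsubst s (bR x A B C) ∧ tsubst t (bR x A B C)) ∘ dup d _).
  { intros [|] A0 B0 C0; cbn.
    - transitivity (mid And (subst s A0 ∧ subst s B0) (subst t A0 ∧ subst t B0) (subst s C0) (subst t C0)
        ∘ ((mid And (subst s A0) (subst t A0) (subst s B0) (subst t B0) ∧ Id _)
        ∘ (((dup d A0 ∧ dup d B0) ∧ dup d C0) ∘ bR And A0 B0 C0))).
      + rw (par_comp And (mid And (subst s A0) (subst t A0) (subst s B0) (subst t B0))
          (dup d A0 ∧ dup d B0) (Id _) (dup d C0)). ids. reflexivity.
      + rewrite <- eqt_b_nat. rw (eqt_sym (mid_b And (subst s A0) (subst t A0) (subst s B0) (subst t B0) (subst s C0) (subst t C0))).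
        rewrite par_comp. ids. reflexivity.
    - transitivity (ck (subst s A0 ∨ subst s B0) (subst t A0 ∨ subst t B0) (subst s C0) (subst t C0)
        ∘ ((ck (subst s A0) (subst t A0) (subst s B0) (subst t B0) ∨ Id _)
        ∘ (((dup d A0 ∨ dup d B0) ∨ dup d C0) ∘ bR Or A0 B0 C0))).
      + rw (par_comp Or (ck (subst s A0) (subst t A0) (subst s B0) (subst t B0))
          (dup d A0 ∨ dup d B0) (Id _) (dup d C0)). ids. reflexivity.
      + rewrite <- eqt_b_nat.
        pose proof (eqt_ck_bOr (subst s A0) (subst s B0) (subst s C0) (subst t A0) (subst t B0) (subst t C0)) as H.
        rewrite <- !eqt_assoc in H. rw H.
        rewrite par_comp. ids. reflexivity. }
  assert (Hd : forall x A, dup d _ ∘ deltaR x A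
     ≡ (tsubst s (deltaR x A) ∧ tsubst t (deltaR x A)) ∘ dup d _).
  { intros [|] A0; cbn.
    - rw (mid_delta And (subst s A0) (subst t A0)).
      rewrite par_comp, eqt_deltaRL. ids. rewrite eqt_delta_nat. reflexivity.
    - rewrite (par_rl Or (dup d A0) wbotL). ra. rewrite (eqt_assoc (ck _ _ _ _)), (eqt_assoc (deltaR Or _ ∧ _)).
      rewrite (eqt_assoc (_ ∧ _) (ck _ _ _ _)), <- eqt_ck_deltaOr. symmetry. apply eqt_delta_nat. }
  assert (Hs : forall x A, dup d _ ∘ sigmaR x A
     ≡ (tsubst s (sigmaR x A) ∧ tsubst t (sigmaR x A)) ∘ dup d _).
  { intros [|] A0; cbn.
    - rw (mid_sigma And (subst s A0) (subst t A0)).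
      rewrite par_comp, <- eqt_delta_sigma, eqt_deltaRL. ids. rewrite eqt_sigma_nat. reflexivity.
    - rewrite (par_lr Or wbotL (dup d A0)). ra. rewrite (eqt_assoc (ck _ _ _ _)), (eqt_assoc (sigmaR Or _ ∧ _)).
      rewrite (eqt_assoc (_ ∧ _) (ck _ _ _ _)), <- eqt_ck_sigmaOr. symmetry. apply eqt_sigma_nat. }
  induction f as [A | A B C g IHg f IHf | x A B A' B' f IHf g IHg | x A B C | x A B C
    | x A B | x A | x A | x A | x A | | | | | | A B C D].
  - cbn. ids. reflexivity.
  - cbn. rewrite eqt_par_comp. rw IHg. rewrite IHf. reflexivity.
  - destruct x; cbn; ra; rewrite par_comp, IHf, IHg, eqt_par_comp.
    + rw (mid_nat And (tsubst s f) (tsubst t f) (tsubst s g) (tsubst t g)). reflexivity.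
    + rw (eqt_ck_nat (tsubst s f) (tsubst t f) (tsubst s g) (tsubst t g)). reflexivity.
  - apply Hb.
  - apply (inv _ _ (bR x A B C)); [apply eqt_bRL | apply eqt_bLR | apply eqt_bLR | apply Hb].
  - destruct x; cbn; ra; rewrite <- eqt_c_nat.
    + rw (mid_c And (subst s A) (subst t A) (subst s B) (subst t B)). reflexivity.
    + rw (eqt_ck_cOr (subst s A) (subst s B) (subst t A) (subst t B)). reflexivity.
  - apply Hd.
  - apply (inv _ _ (deltaR x A)); [apply eqt_deltaRL | apply eqt_deltaLR | apply eqt_deltaLR | apply Hd].
  - apply Hs.
  - apply (inv _ _ (sigmaR x A)); [apply eqt_sigmaRL | apply eqt_sigmaLR | apply eqt_sigmaLR | apply Hs].
  - apply atom_coherence; exact I.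
  - apply atom_coherence; exact I.
  - apply atom_coherence; exact I.
  - apply atom_coherence; exact I.
  - apply atom_coherence; exact I.
  - cbn. rewrite !eqt_par_comp. ra. rewrite <- eqt_ck_nat.
    rw (ck_mid (subst s A) (subst t A) (subst s B) (subst t B) (subst s C) (subst t C) (subst s D) (subst t D)).
    reflexivity.
Qed.

(** * Duality *)

Definition dualc (x : conn) : conn := match x with And => Or | Or => And end.

Fixpoint dual {L} (A : form L) : form L :=
  match A with
  | Letter p => Letter p
  | Unit z => Unit (dualc z)
  | Bin x A B => Bin (dualc x) (dual A) (dual B)
  end.

Fixpoint dterm {L} (A B : form L) (f : term A B) : term (dual B) (dual A) :=
  match f in term A B return term (dual B) (dual A) with
  | Id A => Id (dual A)
  | Comp g f => dterm f ∘ dterm g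
  | Par x f g => Par (dualc x) (dterm f) (dterm g)
  | bR x A B C => bL (dualc x) (dual A) (dual B) (dual C)
  | bL x A B C => bR (dualc x) (dual A) (dual B) (dual C)
  | c x A B => c (dualc x) (dual B) (dual A)
  | deltaR x A => deltaL (dualc x) (dual A)
  | deltaL x A => deltaR (dualc x) (dual A)
  | sigmaR x A => sigmaL (dualc x) (dual A)
  | sigmaL x A => sigmaR (dualc x) (dual A)
  | wbotL => wtopR
  | wbotR => wtopL
  | wtopR => wbotL
  | wtopL => wbotR
  | kappa => kappa
  | ck A B C D => ck (dual A) (dual C) (dual B) (dual D)
  end.

Lemma inv_unique {L} (A B : form L) (i i' : term A B) (j j' : term B A) :
  j ∘ i ≡ Id _ -> i' ∘ j' ≡ Id _ -> i ≡ i' -> j ≡ j'.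
Proof.
  intros H H' E. rewrite <- (eqt_id_r j), <- H', <- E. rw H. apply eqt_id_l.
Qed.

Lemma deltaL_nat {L} x (A A' : form L) (f : term A A') :
  (f ⟨x⟩ Id (Unit x)) ∘ deltaL x A ≡ deltaL x A' ∘ f.
Proof.
  eapply square_inv; [apply eqt_deltaRL | apply eqt_deltaLR | apply eqt_delta_nat].
Qed.

Lemma sigmaL_nat {L} x (A A' : form L) (f : term A A') :
  (Id (Unit x) ⟨x⟩ f) ∘ sigmaL x A ≡ sigmaL x A' ∘ f.
Proof.
  eapply square_inv; [apply eqt_sigmaRL | apply eqt_sigmaLR | apply eqt_sigma_nat].
Qed.

Lemma pentagonL {L} x (A B C D : form L) :
  bL x A B (C ⟨x⟩ D) ∘ bL x (A ⟨x⟩ B) C D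
  ≡ (Id A ⟨x⟩ bL x B C D) ∘ (bL x A (B ⟨x⟩ C) D ∘ (bL x A B C ⟨x⟩ Id D)).
Proof.
  rewrite pentagon2. rw (par_inv x (eqt_id_l (Id A)) (eqt_bLR x B C D)). ids. reflexivity.
Qed.

Lemma hexagonL {L} x (A B C : form L) :
  c x (B ⟨x⟩ C) A
  ≡ bL x A B C ∘ ((c x B A ⟨x⟩ Id C) ∘ (bR x B A C ∘ ((Id B ⟨x⟩ c x C A) ∘ bL x B C A))).
Proof.
  apply (inv_unique (eqt_cc x A (B ⟨x⟩ C)%form)
    (i' := bR x B C A ∘ (Id B ⟨x⟩ c x A C) ∘ bL x B A C ∘ (c x A B ⟨x⟩ Id C) ∘ bR x A B C)).
  - ra. rw (eqt_bRL x A B C). ids. rw (par_inv x (eqt_cc x B A) (eqt_id_l (Id C))). ids.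
    rw (eqt_bLR x B A C). ids. rw (par_inv x (eqt_id_l (Id B)) (eqt_cc x C A)). ids.
    apply eqt_bRL.
  - apply eqt_hexagon.
Qed.

Lemma b_unitL {L} x (A C : form L) : bL x A (Unit x) C ≡ deltaR x A ⟨x⟩ sigmaL x C.
Proof.
  apply (inv_unique (eqt_bLR x A (Unit x) C) (i' := deltaL x A ⟨x⟩ sigmaR x C)).
  - apply par_inv; [apply eqt_deltaLR | apply eqt_sigmaRL].
  - apply eqt_b_unit.
Qed.

Lemma delta_sigmaL {L} x : deltaL x (Unit (L := L) x) ≡ sigmaL x (Unit x).
Proof.
  apply (inv_unique (eqt_deltaLR x (Unit x)) (eqt_sigmaRL x (Unit x)) (eqt_delta_sigma x)).
Qed.

(** The equations are closed under duality: those for [∧] and [∨] change places, and those stated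
    for [bR], [deltaR], [sigmaR] become the versions for the inverses proved above. The two
    equations between [ck] and [kappa] are letterless. *)
Lemma dterm_eqt {L} (A B : form L) (f g : term A B) : f ≡ g -> dterm f ≡ dterm g.
Proof.
  intros E. induction E; cbn [dterm dual dualc].
  - reflexivity.
  - symmetry; assumption.
  - etransitivity; eassumption.
  - apply eqt_comp; assumption.
  - apply eqt_par; assumption.
  - apply eqt_id_r.
  - apply eqt_id_l.
  - symmetry; apply eqt_assoc.
  - apply eqt_par_id.
  - apply eqt_par_comp.
  - symmetry; apply bL_nat.
  - symmetry; apply eqt_c_nat.
  - apply deltaL_nat.
  - apply sigmaL_nat.
  - symmetry; apply eqt_ck_nat.
  - apply eqt_bLR.
  - apply eqt_bRL.
  - apply eqt_cc.
  - apply eqt_deltaLR.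
  - apply eqt_deltaRL.
  - apply eqt_sigmaLR.
  - apply eqt_sigmaRL.
  - apply eqt_wtopLR.
  - apply eqt_wtopRL.
  - apply eqt_wbotLR.
  - apply eqt_wbotRL.
  - apply pentagonL.
  - apply hexagonL.
  - apply delta_sigmaL.
  - apply b_unitL.
  - rewrite eqt_assoc. apply eqt_wbot_b.
  - rewrite eqt_assoc. apply eqt_wtop_b.
  - apply eqt_wbot_c.
  - apply eqt_wtop_c.
  - apply eqt_kappa_wbot_delta.
  - apply eqt_kappa_wbot_sigma.
  - apply eqt_kappa_wtop_delta.
  - apply eqt_kappa_wtop_sigma.
  - rewrite !eqt_assoc. apply eqt_ck_bAnd.
  - rewrite !eqt_assoc. apply eqt_ck_bOr.
  - apply eqt_ck_cAnd.
  - apply eqt_ck_cOr.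
  - rewrite !eqt_assoc. apply eqt_ck_deltaAnd.
  - rewrite !eqt_assoc. apply eqt_ck_sigmaAnd.
  - rewrite !eqt_assoc. apply eqt_ck_deltaOr.
  - rewrite !eqt_assoc. apply eqt_ck_sigmaOr.
  - apply atom_coherence; exact I.
  - apply atom_coherence; exact I.
Qed.

Lemma dual_dual {L} (A : form L) : dual (dual A) = A.
Proof. induction A as [p | [|] | [|] A IHA B IHB]; cbn; congruence. Qed.

Lemma dualc_dualc x : dualc (dualc x) = x.
Proof. destruct x; reflexivity. Qed.

(** Heterogeneous equality is used because [dual (dual A)] and [A] are equal but not convertible. *)
Lemma dterm_dterm {L} (A B : form L) (f : term A B) : JMeq (dterm (dterm f)) f.
Proof.
  induction f; cbn [dterm dual]; rewrite ?dualc_dualc;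
    try (rewrite ?dual_dual; reflexivity).
  - revert IHf1 IHf2. generalize (dterm (dterm f1)) (dterm (dterm f2)).
    rewrite !dual_dual. intros ? ? E1 E2. apply JMeq_eq in E1, E2. subst. reflexivity.
  - revert IHf1 IHf2. generalize (dterm (dterm f1)) (dterm (dterm f2)).
    rewrite !dual_dual. intros ? ? E1 E2. apply JMeq_eq in E1, E2. subst. reflexivity.
Qed.

(** With this, a result on arrows into a conjunction yields the one on arrows out of a
    disjunction. *)
Lemma dterm_faithful {L} (A B : form L) (f g : term A B) : dterm f ≡ dterm g -> f ≡ g.
Proof.
  intros E. apply dterm_eqt in E. revert E.
  generalize (dterm_dterm f) (dterm_dterm g).
  generalize (dterm (dterm f)) (dterm (dterm g)). rewrite !dual_dual.
  intros ? ? E1 E2. apply JMeq_eq in E1, E2. subst. exact (fun E => E).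
Qed.

Lemma letters_dual {L} (A : form L) : letters (dual A) = letters A.
Proof. induction A; cbn; congruence. Qed.

(** * Purity and the letters joined by a conjunction *)

Definition unit_free {L} (A : form L) : Prop := ~ unit_occurs A.

Lemma unit_free_dual {L} (A : form L) : unit_free A -> unit_free (dual A).
Proof. unfold unit_free. induction A; cbn; tauto. Qed.

Lemma unit_free_letter {L} (A : form L) : unit_free A -> exists p, In p (letters A).
Proof.
  unfold unit_free. induction A as [p | z | x A IHA B IHB]; cbn; intros H.
  - exists p; auto.
  - tauto.
  - destruct IHA as [p Hp]; [tauto |]. exists p. apply in_or_app; auto.
Qed.

Lemma unit_free_nu_bin {L} x (M N : form L) :
  unit_free M -> unit_free N -> unit_free (nu_bin x M N).
Proof.
  unfold unit_free. destruct x, M as [p | [|] | y M1 M2], N as [q | [|] | z N1 N2]; cbn; tauto.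
Qed.

Lemma ev_all {L} (v : L -> Prop) (A : form L) :
  unit_free A -> (forall q, In q (letters A) -> v q) -> ev v A.
Proof.
  unfold unit_free. induction A as [p | z | x A IHA B IHB]; cbn; intros H E.
  - auto.
  - tauto.
  - assert (ev v A) by (apply IHA; [tauto | auto using in_or_app]).
    assert (ev v B) by (apply IHB; [tauto | auto using in_or_app]).
    destruct x; auto.
Qed.

Lemma ev_some {L} (v : L -> Prop) (A : form L) :
  unit_free A -> ev v A -> exists q, In q (letters A) /\ v q.
Proof.
  unfold unit_free. induction A as [p | z | x A IHA B IHB]; cbn; intros H E.
  - eauto.
  - tauto.
  - assert (H' : ev v A \/ ev v B) by (destruct x; tauto).
    destruct H' as [H' | H'];
      [destruct IHA as (q & Hq & Hv) | destruct IHB as (q & Hq & Hv)]; try tauto;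
      exists q; auto using in_or_app.
Qed.

(* [linked p q A]: in the cograph of [A], an edge joins [p] and [q]. *)
Fixpoint linked {L} (p q : L) (A : form L) : Prop :=
  match A with
  | Bin And A B => linked p q A \/ linked p q B
      \/ (In p (letters A) /\ In q (letters B)) \/ (In q (letters A) /\ In p (letters B))
  | Bin Or A B => linked p q A \/ linked p q B
  | _ => False
  end.

Lemma in_letters {L} (A B : form L) (f : term A B) p : In p (letters A) <-> In p (letters B).
Proof.
  split; apply Permutation_in; [| apply Permutation_sym]; apply letters_perm, f.
Qed.

Lemma linked_in {L} (p q : L) (A : form L) :
  linked p q A -> In p (letters A) /\ In q (letters A).
Proof.
  induction A as [r | z | [|] A IHA B IHB]; cbn; try tauto;
    rewrite !in_app_iff; tauto.
Qed.

(** No generator removes an edge of the cograph, and [ck A B C D] adds those from [A] to [D] and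
    from [C] to [B]. *)
Lemma linked_mono {L} (p q : L) (A B : form L) (f : term A B) : linked p q A -> linked p q B.
Proof.
  induction f; try destruct x; cbn; rewrite ?in_app_iff; try tauto.
  all: pose proof (in_letters f1 p); pose proof (in_letters f1 q);
    pose proof (in_letters f2 p); pose proof (in_letters f2 q); tauto.
Qed.

Lemma nodup_app {L} (l m : list L) :
  NoDup (l ++ m) -> NoDup l /\ NoDup m /\ forall p, In p l -> In p m -> False.
Proof.
  induction l as [| a l IH]; cbn; intros H.
  - repeat split; auto; constructor.
  - inversion H as [| ? ? Ha Hl]; subst. rewrite in_app_iff in Ha.
    destruct (IH Hl) as (H1 & H2 & H3). repeat split.
    + constructor; tauto.
    + assumption.
    + intros p [<- | Hp] Hm; [tauto | eauto].
Qed.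

Lemma linked_irrefl {L} (p : L) (A : form L) : diversified A -> ~ linked p p A.
Proof.
  unfold diversified. induction A as [r | z | x A IHA B IHB]; cbn; try tauto.
  intros H. apply nodup_app in H as (HA & HB & HAB). specialize (HAB p).
  destruct x; cbn; tauto.
Qed.

(* [blocked K p A]: replacing the letters outside [K] by [⊤] in [A] makes the
   letter [p] the disjunct of a [⊤]. *)
Fixpoint blocked {L} (K : L -> bool) (p : L) (A : form L) : Prop :=
  match A with
  | Bin And A B => blocked K p A \/ blocked K p B
  | Bin Or A B => blocked K p A \/ blocked K p B
      \/ (In p (letters A) /\ forall q, In q (letters B) -> K q = false)
      \/ (In p (letters B) /\ forall q, In q (letters A) -> K q = false)
  | _ => False
  end.

Lemma blocked_in {L} K (p : L) (A : form L) : blocked K p A -> In p (letters A).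
Proof.
  induction A as [r | z | [|] A IHA B IHB]; cbn; try tauto; rewrite !in_app_iff; tauto.
Qed.

(** At the disjunction that blocks [p], one disjunct lies outside [K] and is true. From there up to
    the root, the other side of every conjunction consists of neighbours of [p], so it is true as
    well. *)
Lemma blocked_ev {L} K (p : L) (v : L -> Prop) (A : form L) :
  unit_free A -> (forall q, In q (letters A) -> K q = false -> v q) ->
  (forall q, linked p q A -> v q) -> blocked K p A -> ev v A.
Proof.
  unfold unit_free. induction A as [r | z | [|] A IHA B IHB]; cbn; try tauto;
    intros HU HK HL Hb.
  - destruct Hb as [Hb | Hb]; pose proof (blocked_in Hb); split.
    + apply IHA; auto using in_or_app; tauto.
    + apply ev_all; [unfold unit_free; tauto | intros q Hq; apply HL; tauto].
    + apply ev_all; [unfold unit_free; tauto | intros q Hq; apply HL; tauto].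
    + apply IHB; auto using in_or_app; tauto.
  - destruct Hb as [Hb | [Hb | [[Hp Hq] | [Hp Hq]]]].
    + left; apply IHA; auto using in_or_app; tauto.
    + right; apply IHB; auto using in_or_app; tauto.
    + right. apply ev_all; [unfold unit_free; tauto | auto using in_or_app].
    + left. apply ev_all; [unfold unit_free; tauto | auto using in_or_app].
Qed.

(** Falsity climbs from [p] to the root. It passes a conjunction at once; at a disjunction the other
    side contains no neighbour of [p], since no letter is repeated, so no letter there is true. *)
Lemma linked_ev {L} (p : L) (v : L -> Prop) (A : form L) :
  unit_free A -> diversified A -> In p (letters A) -> ~ v p ->
  (forall q, In q (letters A) -> v q -> linked p q A) -> ~ ev v A.
Proof.
  unfold unit_free, diversified.
  induction A as [r | z | x A IHA B IHB]; cbn; intros HU HD Hp Hv HL.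
  - destruct Hp as [-> | []]; assumption.
  - tauto.
  - apply nodup_app in HD as (HA & HB & HAB). apply in_app_or in Hp.
    assert (R : forall q, In q (letters A) \/ In q (letters B) -> v q ->
       linked p q (Bin x A B)).
    { intros q Hq. apply HL, in_or_app, Hq. }
    assert (LA := fun q => @linked_in L p q A). assert (LB := fun q => @linked_in L p q B).
    destruct Hp as [Hp | Hp].
    + assert (EA : ~ ev v A).
      { apply IHA; auto; try tauto. intros q Hq Hvq. specialize (R q (or_introl Hq) Hvq).
        specialize (LB q). pose proof (HAB p). pose proof (HAB q). destruct x; cbn in R; tauto. }
      destruct x; cbn; [tauto |]. intros [E | E]; [tauto |].
      destruct (ev_some (A := B) ltac:(unfold unit_free; tauto) E) as (q & Hq & Hvq).
      specialize (R q (or_intror Hq) Hvq). cbn in R.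
      specialize (LA q). specialize (LB q). pose proof (HAB p). pose proof (HAB q). tauto.
    + assert (EB : ~ ev v B).
      { apply IHB; auto; try tauto. intros q Hq Hvq. specialize (R q (or_intror Hq) Hvq).
        specialize (LA q). pose proof (HAB p). pose proof (HAB q). destruct x; cbn in R; tauto. }
      destruct x; cbn; [tauto |]. intros [E | E]; [| tauto].
      destruct (ev_some (A := A) ltac:(unfold unit_free; tauto) E) as (q & Hq & Hvq).
      specialize (R q (or_introl Hq) Hvq). cbn in R.
      specialize (LA q). specialize (LB q). pose proof (HAB p). pose proof (HAB q). tauto.
Qed.

(** If [p] were blocked, a suitable valuation would make [A] true and [B] false, against
    [ev_mono]. *)
Lemma not_blocked {L} K (A B C : form L) (f : term A (B ∧ C)%form) (p : L) :
  unit_free A -> unit_free (B ∧ C) -> diversified A -> diversified (B ∧ C) ->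
  (forall q, In q (letters B) -> K q = true) -> (forall q, In q (letters C) -> K q = false) ->
  K p = true -> ~ blocked K p A.
Proof.
  intros UA UBC DA DBC HB HC Hp Hb.
  assert (IA := in_letters f). cbn in IA.
  assert (In p (letters B)) as HpB.
  { pose proof (blocked_in Hb) as Hi. rewrite IA, in_app_iff in Hi.
    destruct Hi as [Hi | Hi]; [assumption | rewrite HC in Hp by assumption; discriminate]. }
  (* True outside [K], as forced by [⊤], and at the neighbours of [p] in [A]. In [B] only the latter
     remain, and by [linked_mono] they are still neighbours of [p] there. *)
  pose (v := fun q => K q = false \/ linked p q A).
  assert (E : ev v A) by (apply (blocked_ev (K := K) (p := p)); unfold v; auto).
  apply (ev_mono f) in E. destruct E as [E _]. revert E.
  unfold unit_free in UBC; cbn in UBC. apply nodup_app in DBC as (DB & DC & DBC).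
  apply (linked_ev (p := p)); auto.
  - unfold unit_free; tauto.
  - unfold v. rewrite Hp. intros [| Hl]; [discriminate |]. apply (linked_irrefl DA Hl).
  - intros q Hq [Hv | Hv]; [rewrite HB in Hv by assumption; discriminate |].
    apply (linked_mono f) in Hv. cbn in Hv.
    pose proof (@linked_in L p q C). pose proof (DBC p). pose proof (DBC q). tauto.
Qed.

Definition restr {L} (K : L -> bool) (p : L) : form L := if K p then Letter p else ⊤.

Lemma letters_restr {L} (K : L -> bool) (A : form L) :
  letters (subst (restr K) A) = filter K (letters A).
Proof.
  induction A as [p | z | x A IHA B IHB]; cbn; try reflexivity.
  - unfold restr. destruct (K p); reflexivity.
  - rewrite filter_app, IHA, IHB. reflexivity.
Qed.

Lemma nu_restr_top {L} (K : L -> bool) (A : form L) :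
  unit_free A -> (forall q, In q (letters A) -> K q = false) ->
  nu (subst (restr K) A) = ⊤.
Proof.
  unfold unit_free. induction A as [p | z | x A IHA B IHB]; cbn; intros HU HK.
  - unfold restr. rewrite HK by auto. reflexivity.
  - tauto.
  - rewrite IHA, IHB by (auto using in_or_app; tauto). destruct x; reflexivity.
Qed.

Lemma meets_dec {L} (K : L -> bool) (l : list L) :
  (exists p, In p l /\ K p = true) \/ (forall q, In q l -> K q = false).
Proof.
  destruct (existsb K l) eqn:E; [left; apply existsb_exists, E | right].
  intros q Hq. destruct (K q) eqn:F; [| reflexivity].
  rewrite <- E. symmetry. apply existsb_exists. eauto.
Qed.

(** A subformula without letters of [K] normalizes to [⊤]. As a conjunct it disappears; as a
    disjunct it would block the letters of [K] on the other side. *)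
Lemma pure_restr {L} (K : L -> bool) (A : form L) :
  unit_free A -> (exists p, In p (letters A) /\ K p = true) ->
  (forall p, K p = true -> ~ blocked K p A) -> pure (subst (restr K) A).
Proof.
  unfold unit_free, pure. induction A as [p | z | x A IHA B IHB]; cbn; intros HU HE HK.
  - destruct HE as (q & [<- | []] & Hq). unfold restr. rewrite Hq. cbn. tauto.
  - tauto.
  - assert (HKA : forall p, K p = true -> ~ blocked K p A).
    { intros p Hp. specialize (HK p Hp). destruct x; tauto. }
    assert (HKB : forall p, K p = true -> ~ blocked K p B).
    { intros p Hp. specialize (HK p Hp). destruct x; tauto. }
    destruct (meets_dec K (letters A)) as [MA | MA], (meets_dec K (letters B)) as [MB | MB].
    + apply unit_free_nu_bin; [apply IHA | apply IHB]; tauto.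
    + destruct x.
      * rewrite (nu_restr_top (A := B)) by (unfold unit_free; tauto).
        specialize (IHA ltac:(tauto) MA HKA).
        destruct (nu (subst (restr K) A)) as [| [|] |]; cbn in *; tauto.
      * destruct MA as (p & HpA & Hp). exfalso. apply (HK p Hp). tauto.
    + destruct x.
      * rewrite (nu_restr_top (A := A)) by (unfold unit_free; tauto).
        specialize (IHB ltac:(tauto) MB HKB).
        destruct (nu (subst (restr K) B)) as [| [|] |]; cbn in *; tauto.
      * destruct MB as (p & HpB & Hp). exfalso. apply (HK p Hp). tauto.
    + destruct HE as (p & Hi & Hp). apply in_app_or in Hi as [Hi | Hi];
        [rewrite MA in Hp | rewrite MB in Hp]; easy.
Qed.

(** * Coherence for pure formulae *)

(** If the second copy of each letter of [A] can be discarded, so can the second copy of [A]. The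
    induction uses the unit equations of [mid] and [ck]. *)
Lemma dup_retract_l {L} (s t : L -> form L) (d : forall p, term (Letter p) (s p ∧ t p))
    (A : form L) :
  (forall p, In p (letters A) -> exists (e : term (s p) (Letter p)) (u : term (t p) ⊤),
     deltaR And _ ∘ ((e ∧ u) ∘ d p) ≡ Id _) ->
  exists (e : term (subst s A) A) (u : term (subst t A) ⊤),
    deltaR And _ ∘ ((e ∧ u) ∘ dup d A) ≡ Id _.
Proof.
  induction A as [p | [|] | x A IHA B IHB]; cbn; intros H.
  - auto.
  - exists (Id _), (Id _). ids. apply eqt_deltaRL.
  - exists (Id _), kappa. rewrite <- eqt_kappa_wbot_delta. apply eqt_deltaRL.
  - destruct IHA as (e & u & E); [auto using in_or_app |].
    destruct IHB as (e' & u' & E'); [auto using in_or_app |].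
    destruct x.
    + exists (e ∧ e'), (deltaR And _ ∘ (u ∧ u')).
      rewrite <- (eqt_id_l (e ∧ e')), eqt_par_comp. ra.
      rw (eqt_sym (mid_nat And e u e' u')). rewrite par_comp.
      rw (mid_delta' And A B). rewrite par_comp, E, E'. apply eqt_par_id.
    + exists (e ∨ e'), (wtopR ∘ (u ∨ u')).
      rewrite <- (eqt_id_l (e ∨ e')), eqt_par_comp. ra.
      rw (eqt_sym (eqt_ck_nat e u e' u')). rewrite par_comp.
      rw (ck_delta_and (Id (A ∨ B)%form)). ids. rewrite par_comp, E, E'. apply eqt_par_id.
Qed.

Lemma dup_retract_r {L} (s t : L -> form L) (d : forall p, term (Letter p) (s p ∧ t p))
    (A : form L) :
  (forall p, In p (letters A) -> exists (u : term (s p) ⊤) (e : term (t p) (Letter p)),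
     sigmaR And _ ∘ ((u ∧ e) ∘ d p) ≡ Id _) ->
  exists (u : term (subst s A) ⊤) (e : term (subst t A) A),
    sigmaR And _ ∘ ((u ∧ e) ∘ dup d A) ≡ Id _.
Proof.
  induction A as [p | [|] | x A IHA B IHB]; cbn; intros H.
  - auto.
  - exists (Id _), (Id _). ids. rewrite <- eqt_delta_sigma. apply eqt_deltaRL.
  - exists kappa, (Id _). rewrite <- eqt_kappa_wbot_sigma. apply eqt_sigmaRL.
  - destruct IHA as (u & e & E); [auto using in_or_app |].
    destruct IHB as (u' & e' & E'); [auto using in_or_app |].
    destruct x.
    + exists (sigmaR And _ ∘ (u ∧ u')), (e ∧ e').
      rewrite <- (eqt_id_l (e ∧ e')), eqt_par_comp. ra.
      rw (eqt_sym (mid_nat And u e u' e')). rewrite par_comp.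
      rw (mid_sigma' And A B). rewrite par_comp, E, E'. apply eqt_par_id.
    + exists (wtopR ∘ (u ∨ u')), (e ∨ e').
      rewrite <- (eqt_id_l (e ∨ e')), eqt_par_comp. ra.
      rw (eqt_sym (eqt_ck_nat u e u' e')). rewrite par_comp.
      rw (ck_sigma_and (Id (A ∨ B)%form)). ids. rewrite par_comp, E, E'. apply eqt_par_id.
Qed.

Definition split_letter {L} (K : L -> bool) (p : L) :
  term (Letter p) (restr K p ∧ restr (fun q => negb (K q)) p).
Proof.
  unfold restr. destruct (K p); [exact (deltaL And _) | exact (sigmaL And _)].
Defined.

(** The retraction keeps the first copy of [A] and the second copy of [B] and sends the others to
    [⊤]. The middle exchange left over has [⊤] in both inner places and is the identity. *)
Lemma dup_and_retract {L} (K : L -> bool) (A B : form L) :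
  (forall q, In q (letters A) -> K q = true) ->
  (forall q, In q (letters B) -> K q = false) ->
  exists r, r ∘ dup (split_letter K) (A ∧ B)%form ≡ Id _.
Proof.
  intros HA HB.
  destruct (dup_retract_l (d := split_letter K) (A := A)) as (e & u & E).
  { intros p Hp. unfold split_letter, restr. rewrite HA by assumption.
    exists (Id _), (Id _). cbn. ids. apply eqt_deltaRL. }
  destruct (dup_retract_r (d := split_letter K) (A := B)) as (u' & e' & E').
  { intros p Hp. unfold split_letter, restr. rewrite HB by assumption.
    exists (Id _), (Id _). cbn. ids. apply eqt_sigmaRL. }
  exists ((deltaR And A ∧ sigmaR And B) ∘ ((e ∧ u') ∧ (u ∧ e'))). cbn. ra.
  rw (eqt_sym (mid_nat And e u u' e')). rewrite mid_unit. ids.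
  rewrite !par_comp, E, E'. apply eqt_par_id.
Qed.

Lemma filter_length_lt {T} (K : T -> bool) (l : list T) (q : T) :
  In q l -> K q = false -> length (filter K l) < length l.
Proof.
  intros Hq HK. induction l as [| a l IH]; cbn in *; [contradiction |].
  pose proof (filter_length_le K l). destruct Hq as [-> | Hq].
  - rewrite HK. lia.
  - specialize (IH Hq). destruct (K a); cbn; lia.
Qed.

(** Stated for pure rather than unit-free formulae, because restricting the letters introduces
    [⊤]. *)
Definition coherent (n : nat) : Prop := forall L (A B : form L) (f g : term A B),
  pure A -> diversified A -> pure B -> diversified B -> length (letters A) < n -> f ≡ g.

Lemma diversified_restr {L} (K : L -> bool) (A : form L) :
  diversified A -> diversified (subst (restr K) A).
Proof. unfold diversified. rewrite letters_restr. apply NoDup_filter. Qed.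

(** The induction hypothesis applies: [not_blocked] gives purity, for the target by taking the
    identity as the arrow, and the letters of [C] are lost. *)
Lemma tsubst_restr_coherence {L} (K : L -> bool) (A B C : form L)
    (f g : term A (B ∧ C)%form) :
  coherent (length (letters A)) ->
  unit_free A -> unit_free (B ∧ C) -> diversified A -> diversified (B ∧ C) ->
  (forall q, In q (letters B) -> K q = true) -> (forall q, In q (letters C) -> K q = false) ->
  tsubst (restr K) f ≡ tsubst (restr K) g.
Proof.
  intros IH UA UBC DA DBC HB HC.
  assert (P := letters_perm f).
  destruct (unit_free_letter (A := B)) as (b & Hb); [unfold unit_free in *; cbn in *; tauto |].
  destruct (unit_free_letter (A := C)) as (c & Hc); [unfold unit_free in *; cbn in *; tauto |].
  assert (Ib : In b (letters (B ∧ C))) by (apply in_or_app; auto).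
  assert (Ic : In c (letters (B ∧ C))) by (apply in_or_app; auto).
  apply IH; auto using diversified_restr.
  - apply pure_restr; auto.
    + exists b. split; [apply (in_letters f), Ib | auto].
    + intros p. apply (not_blocked f); assumption.
  - apply (pure_restr (A := B ∧ C)%form); auto.
    + exists b. auto.
    + intros p. apply (not_blocked (Id (B ∧ C)%form)); assumption.
  - rewrite letters_restr. apply (filter_length_lt (q := c)); auto.
    apply (in_letters f), Ic.
Qed.

Lemma coherence_into_and {L} (A B C : form L) (f g : term A (B ∧ C)%form) :
  coherent (length (letters A)) ->
  unit_free A -> unit_free (B ∧ C) -> diversified A -> diversified (B ∧ C) -> f ≡ g.
Proof.
  intros IH UA UBC DA DBC.
  assert (DBC' := nodup_app DBC). destruct DBC' as (DB & DC & HBC).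
  (* Equality of letters is not assumed decidable, so membership is decided classically. *)
  pose (K := fun q => if excluded_middle_informative (In q (letters B)) then true else false).
  assert (HB : forall q, In q (letters B) -> K q = true).
  { intros q Hq. unfold K. destruct excluded_middle_informative; tauto. }
  assert (HC : forall q, In q (letters C) -> K q = false).
  { intros q Hq. unfold K. destruct excluded_middle_informative; [exfalso; eauto | reflexivity]. }
  destruct (dup_and_retract HB HC) as (r & Hr).
  apply (cancel_l Hr). rewrite !dup_nat.
  rewrite (@tsubst_restr_coherence L K A B C f g) by assumption.
  enough (E : tsubst (restr (fun q => negb (K q))) f ≡ tsubst (restr (fun q => negb (K q))) g)
    by (rewrite E; reflexivity).
  (* Composition with the symmetry interchanges [B] and [C], so the previous lemma covers the
     complement of [K] too. *)
  assert (E : tsubst (restr (fun q => negb (K q))) (c And B C ∘ f)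
    ≡ tsubst (restr (fun q => negb (K q))) (c And B C ∘ g)).
  { apply tsubst_restr_coherence; auto.
    - unfold unit_free in *; cbn in *; tauto.
    - unfold diversified in *. cbn in *.
      apply (Permutation_NoDup (Permutation_app_comm (letters B) (letters C)) DBC).
    - intros q Hq. rewrite HC by assumption. reflexivity.
    - intros q Hq. rewrite HB by assumption. reflexivity. }
  exact (cancel_l (eqt_cc And _ _) E).
Qed.

Lemma unit_free_coherence {L} (A B : form L) (f g : term A B) :
  coherent (length (letters A)) ->
  unit_free A -> unit_free B -> diversified A -> diversified B -> f ≡ g.
Proof.
  intros IH UA UB DA DB.
  assert (P := Permutation_length (letters_perm f)).
  destruct B as [q | z | [|] B1 B2].
  2: { exfalso; apply UB; exact I. }
  2: { apply coherence_into_and; assumption. }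
  (* A disjunction as source is dual to a conjunction as target. What remains has a letter or a
     conjunction as source and a letter or a disjunction as target; counting letters excludes the
     mixed cases with one letter. *)
  all: destruct A as [p | z | [|] A1 A2];
    try (exfalso; apply UA; exact I);
    try (apply dterm_faithful, coherence_into_and; unfold diversified;
         rewrite ?letters_dual;
         [exact (eq_ind _ coherent IH _ P) | apply unit_free_dual, UB
         | apply (unit_free_dual UA) | exact DB
         | cbn; rewrite ?letters_dual; exact DA]).
  all: unfold unit_free in UA, UB; cbn in UA, UB.
  - apply atom_coherence; exact I.
  - destruct (unit_free_letter (A := A1)) as (a & Ha); [unfold unit_free; tauto |].
    destruct (unit_free_letter (A := A2)) as (b & Hb); [unfold unit_free; tauto |].
    cbn in P. rewrite length_app in P.
    destruct (letters A1), (letters A2); cbn in *; try contradiction; lia.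
  - destruct (unit_free_letter (A := B1)) as (a & Ha); [unfold unit_free; tauto |].
    destruct (unit_free_letter (A := B2)) as (b & Hb); [unfold unit_free; tauto |].
    cbn in P. rewrite length_app in P.
    destruct (letters B1), (letters B2); cbn in *; try contradiction; lia.
  - exfalso.
    destruct (unit_free_letter (A := A1)) as (a & Ha); [unfold unit_free; tauto |].
    destruct (unit_free_letter (A := A2)) as (a' & Ha'); [unfold unit_free; tauto |].
    destruct (unit_free_letter (A := B1)) as (b & Hb); [unfold unit_free; tauto |].
    destruct (unit_free_letter (A := B2)) as (b' & Hb'); [unfold unit_free; tauto |].
    destruct (nodup_app DB) as (_ & _ & HB).
    assert (J := in_letters f). cbn in J.
    (* Each letter of [A1] is joined to each letter of [A2], and an edge survives only inside [B1]
       or inside [B2]. The letters of [A] are thus connected and all lie on one side, yet both sides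
       have letters. *)
    assert (sep : forall p q, In p (letters A1) -> In q (letters A2) ->
       (In p (letters B1) /\ In q (letters B1)) \/ (In p (letters B2) /\ In q (letters B2))).
    { intros p q Hp Hq.
      assert (Hl : linked p q (A1 ∧ A2)) by (cbn; tauto).
      apply (linked_mono f) in Hl. cbn in Hl.
      destruct Hl as [Hl | Hl]; apply linked_in in Hl; tauto. }
    assert (J1 := J b). assert (J2 := J b'). rewrite !in_app_iff in J1, J2.
    pose proof (HB a). pose proof (HB a'). pose proof (HB b). pose proof (HB b').
    pose proof (sep a a'). pose proof (sep a b'). pose proof (sep a b).
    pose proof (sep b a'). pose proof (sep b' a'). tauto.
Qed.

Lemma coherent_all n : coherent n.
Proof.
  induction n as [n IH] using lt_wf_ind. intros L A B f g PA DA PB DB Hn.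
  (* The isomorphisms with the normal forms replace [A] and [B] by [nu A] and [nu B], which are
     unit-free by purity and have the same letters. *)
  apply (cancel_r (phiI_phi A)), (cancel_l (phiI_phi B)).
  apply unit_free_coherence; unfold diversified; rewrite ?letters_nu; try assumption.
  apply IH, Hn.
Qed.

(** * From arrow terms to arrows *)

Lemma arrow_eq {L} (A B : form L) (f g : arrow A B) :
  (forall t u : term A B, t ≡ u) -> f = g.
Proof.
  intros H. destruct f as [P HP], g as [Q HQ].
  assert (E : P = Q).
  { destruct HP as [t ->], HQ as [u ->].
    apply functional_extensionality; intros h. apply propositional_extensionality.
    split; intros _; apply H. }
  subst Q. f_equal. apply proof_irrelevance.
Qed.

Local Close Scope term_scope.
Local Close Scope form_scope.

Theorem mainTheorem7 (L : Type) (L_nonempty : inhabited L) (A B : form L)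
    (f g : arrow A B) :
  ((pure A /\ diversified A) /\ (pure B /\ diversified B)) \/
  (letterless A /\ letterless B) ->
  f = g.
Proof.
  intros [[[PA DA] [PB DB]] | [HA HB]]; apply arrow_eq; intros t u.
  (* The successor appears because [coherent] bounds the number of letters strictly. *)
  - apply (coherent_all (n := S (length (letters A)))); auto.
  - assert (N : forall C : form L, letterless C -> atom (nu C)).
    { intros C HC. destruct (nu_letterless (A := C)) as [z ->]; [| exact I].
      destruct (letters C) as [| p l] eqn:E; [reflexivity |].
      destruct (HC p). rewrite E. left; reflexivity. }
    apply atom_coherence; apply N; assumption.
Qed.
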